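(* Let the spacetime $(M,g_{ab},\phi)$, with $\phi$ a real scalar field, be a solution to the gravitational field equation $E_{ab} = 8\pi T_{ab}$ with the energy-momentum tensor $$T_{ab} = \nabla_a\phi\,\nabla_b\phi - \left(\tfrac12 \nabla_c\phi\,\nabla^c\phi + V(\phi)\right) g_{ab},$$ allowing a Killing vector field $\xi^a$. Then the symmetry is inherited by the scalar field, $\pounds_\xi\phi = 0$, at each point where $V'(\phi)\neq 0$. On each $\xi$-open set $O_\xi\subset M$ where $V'(\phi)=0$ and $\pounds_\xi\phi$ is a $C^1$ function, $\mathrm{d}(\pounds_\xi\phi)=0$ holds on $O_\xi$. Furthermore, assuming that the orbits of $\xi^a$ don't run into a singularity, the symmetry inheritance $\pounds_\xi\phi=0$ will hold within $O_\xi$ if these curves are compact (topological circles) or if $\phi$ is bounded on noncompact orbits. Conversely, on any $\xi$-open set $O_\xi\subset M$ where both $\mathrm{d}(\pounds_\xi\phi)$ and $V'(\phi)\,\pounds_\xi\phi$ identically vanish, the equation $\pounds_\xi T_{ab}=0$ necessarily holds.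
   Context: $M$ is a Hausdorff paracompact connected $D$-dimensional manifold, $g_{ab}$ is a metric of Lorentzian type with signature $(-,+,+,\dots)$ and covariant derivative $\nabla_a$; $M$, $g_{ab}$ and $\phi$ are smooth. $E_{ab}$ is some polynomial in Riemann tensors, which might contain covariant derivatives and the Levi-Civita tensor (e.g. the Einstein tensor plus $\Lambda g_{ab}$, or a Lovelock tensor). $V=V(\phi)$ is a general scalar potential, and $V'(\phi)=\mathrm{d}V(\phi)/\mathrm{d}\phi$. $\pounds_\xi$ is the Lie derivative along $\xi^a$, and $\xi^a$ being Killing means $\pounds_\xi g_{ab}=0$. A $\xi$-open set is a nonempty open set $O_\xi\subset M$ invariant under the action of $\xi^a$: any orbit of $\xi^a$ is either completely contained in $O_\xi$ or disjoint from it. *)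

(* Defs.v *)
(* Smooth manifolds are topological spaces with a smooth atlas.  Tensor fields
   are given, as in classical tensor calculus, by their components in every
   chart of the atlas, subject to the tensor transformation law.  All tensors
   are covariant, indices being raised with the inverse metric. *)
From HB Require Import structures.
From mathcomp Require Import all_boot all_order all_algebra perm.
From mathcomp Require Import all_classical all_reals all_analysis.

Set Implicit Arguments.
Unset Strict Implicit.
Unset Printing Implicit Defensive.

Import Order.TTheory GRing.Theory Num.Theory.
Import numFieldNormedType.Exports.

Local Open Scope classical_set_scope.
Local Open Scope ring_scope.

Section Calculus.
Context {R : realType} {D : nat}.

Definition pd (i : 'I_D) (f : 'rV[R]_D -> R) (x : 'rV[R]_D) : R :=
  'D_(delta_mx 0 i) f x.

(* Meant for open [U]: then only the germs of [f] at the points of [U] matter,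
   and [f] may take arbitrary values outside of [U]. *)
Fixpoint Ck_on (k : nat) (U : set 'rV[R]_D) (f : 'rV[R]_D -> R) : Prop :=
  (forall x, U x -> {for x, continuous f}) /\
  match k with
  | 0%N => True
  | k'.+1 => forall i : 'I_D,
      (forall x, U x -> derivable f x (delta_mx 0 i)) /\ Ck_on k' U (pd i f)
  end.

Definition smooth_on (U : set 'rV[R]_D) (f : 'rV[R]_D -> R) : Prop :=
  forall k, Ck_on k U f.

End Calculus.

Section Manifold.
Context {R : realType} (D : nat) (M : topologicalType).

Definition paracompact : Prop :=
  forall U : set (set M),
    (forall A, U A -> open A) -> \bigcup_(A in U) A = setT ->
  exists V : set (set M),
    [/\ forall B, V B -> open B,
        \bigcup_(B in V) B = setT,
        forall B, V B -> exists2 A, U A & B `<=` A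
      & forall p : M, exists2 N, nbhs p N &
          finite_set [set B | V B /\ B `&` N !=set0]].

(* [cinv] is only meaningful on the image [cimg] of the domain. *)
Record chart := Chart {
  cdom : set M ;
  cmap : M -> 'rV[R]_D ;
  cinv : 'rV[R]_D -> M }.

Definition cimg (c : chart) : set 'rV[R]_D := cmap c @` cdom c.

Definition is_chart (c : chart) : Prop :=
  [/\ open (cdom c),
      open (cimg c),
      forall p, cdom c p -> cinv c (cmap c p) = p,
      forall p, cdom c p -> {for p, continuous (cmap c)}
    & forall x, cimg c x -> {for x, continuous (cinv c)}].

Definition is_atlas (A : set chart) : Prop :=
  [/\ forall c, A c -> is_chart c,
      \bigcup_(c in A) cdom c = setT
    & forall c c', A c -> A c' -> forall i : 'I_D,
        smooth_on (cmap c @` (cdom c `&` cdom c'))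
          (fun x => cmap c' (cinv c x) 0 i)].

(* d x'^i / d x^j, for the coordinates x of [c] and x' of [c'] *)
Definition jac (c c' : chart) (x : 'rV[R]_D) (i j : 'I_D) : R :=
  pd j (fun y => cmap c' (cinv c y) 0 i) x.

(* [T c x I] is the component T_I, I = (i_1, ..., i_k), in the chart [c] at the
   point with coordinates [x]; only x in [cimg c] is meaningful. *)
Definition tensor_field (k : nat) : Type := chart -> 'rV[R]_D -> k.-tuple 'I_D -> R.

Definition is_tensor (A : set chart) (k : nat) (T : tensor_field k) : Prop :=
  [/\ forall c, A c -> forall I, smooth_on (cimg c) (fun x => T c x I)
    & forall c c', A c -> A c' -> forall p, cdom c p -> cdom c' p ->
      forall I : k.-tuple 'I_D,
        T c (cmap c p) I =
        \sum_(J : k.-tuple 'I_D)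
          (\prod_(s < k) jac c c' (cmap c p) (tnth J s) (tnth I s)) *
          T c' (cmap c' p) J].

(* [xi c x i] is the component xi^i *)
Definition vector_field : Type := chart -> 'rV[R]_D -> 'I_D -> R.

Definition is_vector (A : set chart) (xi : vector_field) : Prop :=
  [/\ forall c, A c -> forall i, smooth_on (cimg c) (fun x => xi c x i)
    & forall c c', A c -> A c' -> forall p, cdom c p -> cdom c' p ->
      forall i : 'I_D,
        xi c' (cmap c' p) i =
        \sum_(j < D) jac c c' (cmap c p) i j * xi c (cmap c p) j].

Definition smooth_function (A : set chart) (phi : M -> R) : Prop :=
  forall c, A c -> smooth_on (cimg c) (fun x => phi (cinv c x)).

Definition scalar_field (phi : M -> R) : tensor_field 0 := fun c x _ => phi (cinv c x).

Definition vanishes_at (A : set chart) (k : nat) (T : tensor_field k) (p : M) : Prop :=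
  forall c, A c -> cdom c p -> forall I, T c (cmap c p) I = 0.

Definition C1_function_on (A : set chart) (O : set M) (f : tensor_field 0) : Prop :=
  forall c, A c ->
    Ck_on 1 (cmap c @` (cdom c `&` O)) (fun x => f c x [tuple]).

Definition differential (f : tensor_field 0) : tensor_field 1 :=
  fun c x I => pd (thead I) (fun y => f c y [tuple]) x.

(* the multi-index [I] with its [s]-th entry replaced by [a] *)
Definition subst_index (k : nat) (I : k.-tuple 'I_D) (s : 'I_k) (a : 'I_D) :
  k.-tuple 'I_D := [tuple if r == s then a else tnth I r | r < k].

Definition permute_index (k : nat) (s : 'S_k) (I : k.-tuple 'I_D) :
  k.-tuple 'I_D := [tuple tnth I (s r) | r < k].

Definition lie (xi : vector_field) (k : nat) (T : tensor_field k) :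
  tensor_field k :=
  fun c x I =>
    \sum_(a < D) xi c x a * pd a (fun y => T c y I) x +
    \sum_(s < k) \sum_(a < D)
      pd (tnth I s) (fun y => xi c y a) x * T c x (subst_index I s a).

Definition integral_curve (A : set chart) (xi : vector_field) (J : set R)
    (gamma : R -> M) : Prop :=
  forall t, J t ->
    {for t, continuous gamma} /\
    forall c, A c -> cdom c (gamma t) -> forall i : 'I_D,
      is_derive t 1 (fun s => cmap c (gamma s) 0 i)
        (xi c (cmap c (gamma t)) i).

(* The orbit of [xi] through [p] is the image of the maximal integral curve
   through [p]: the union of all integral curves through [p] which are defined
   on an open interval. *)
Definition orbit_of (A : set chart) (xi : vector_field) (p : M) : set M :=
  [set q | exists (J : set R) (gamma : R -> M) (t : R),
    [/\ open J, is_interval J, integral_curve A xi J gamma,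
        J 0 /\ gamma 0 = p & J t /\ gamma t = q]].

Definition xi_open (A : set chart) (xi : vector_field) (O : set M) : Prop :=
  [/\ O !=set0, open O
    & forall p, orbit_of A xi p `<=` O \/ orbit_of A xi p `&` O = set0].

(* the integral curve of [xi] starting at [p] exists for all parameter values *)
Definition complete_orbit (A : set chart) (xi : vector_field) (p : M) :
  Prop :=
  exists gamma : R -> M, gamma 0 = p /\ integral_curve A xi setT gamma.

End Manifold.

Section Lorentzian.
Context {R : realType} (D : nat) (M : topologicalType).
Let chart := @chart R D M.
Let tensor_field := @tensor_field R D M.
Let vector_field := @vector_field R D M.

Definition metric_mx (g : tensor_field 2) (c : chart) (x : 'rV[R]_D) : 'M[R]_D :=
  \matrix_(a, b) g c x [tuple a; b].

(* diag (-1, 1, ..., 1) *)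
Definition minkowski : 'M[R]_D :=
  diag_mx (\row_(i < D) (if val i == 0%N then - 1 else 1)).

Definition is_lorentzian_metric (A : set chart) (g : tensor_field 2) : Prop :=
  [/\ is_tensor A g,
      forall c x, A c -> cimg c x -> (metric_mx g c x)^T = metric_mx g c x
    & forall c x, A c -> cimg c x ->
        exists2 P : 'M[R]_D, P \in unitmx &
          P *m metric_mx g c x *m P^T = minkowski].

Definition inverse_metric (g : tensor_field 2) (c : chart) (x : 'rV[R]_D)
  (a b : 'I_D) : R := invmx (metric_mx g c x) a b.

(* [christoffel g c x a b e] is Gamma^a_{be} *)
Definition christoffel (g : tensor_field 2) (c : chart) (x : 'rV[R]_D)
    (a b e : 'I_D) : R :=
  2^-1 * \sum_(d < D) inverse_metric g c x a d *
    (pd b (fun y => g c y [tuple d; e]) x +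
     pd e (fun y => g c y [tuple b; d]) x -
     pd d (fun y => g c y [tuple b; e]) x).

(* The derivative index comes first: the component at (a, i_1, ..., i_k) is
   nabla_a T_{i_1 ... i_k}. *)
Definition nabla (g : tensor_field 2) (k : nat) (T : tensor_field k) : tensor_field k.+1 :=
  fun c x I =>
    let a := thead I in
    let J : k.-tuple 'I_D := [tuple of behead I] in
    pd a (fun y => T c y J) x -
    \sum_(s < k) \sum_(d < D)
      christoffel g c x d a (tnth J s) * T c x (subst_index J s d).

(* R_{abcd} = g_{ae} R^e_{bcd}, where R^e_{bcd} = d_c Gamma^e_{db}
   - d_d Gamma^e_{cb} + Gamma^e_{cf} Gamma^f_{db} - Gamma^e_{df} Gamma^f_{cb} *)
Definition riemann (g : tensor_field 2) : tensor_field 4 := fun c x I =>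
  let i0 := tnth I (inord 0) in let i1 := tnth I (inord 1) in
  let i2 := tnth I (inord 2) in let i3 := tnth I (inord 3) in
  \sum_(e < D) g c x [tuple i0; e] *
    (pd i2 (fun y => christoffel g c y e i3 i1) x -
     pd i3 (fun y => christoffel g c y e i2 i1) x +
     \sum_(f < D)
       (christoffel g c x e i2 f * christoffel g c x f i3 i1 -
        christoffel g c x e i3 f * christoffel g c x f i2 i1)).

(* eps_{i_1 ... i_D} = +/- sqrt |det g| [i_1 ... i_D], where [i_1 ... i_D] is
   the totally antisymmetric symbol; a field [eps] as below exists exactly when
   the manifold is orientable, and encodes the choice of an orientation. *)
Definition is_levi_civita (A : set chart) (g : tensor_field 2) (eps : tensor_field D) :
  Prop :=
  [/\ is_tensor A eps,
      forall c x, A c -> cimg c x -> forall (s : 'S_D) I,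
        eps c x (permute_index s I) = (-1) ^+ s * eps c x I
    & forall c x, A c -> cimg c x ->
        `|eps c x [tuple i | i < D]| = Num.sqrt `|\det (metric_mx g c x)| ].

(* Tensors of rank [k] which are polynomial in the Riemann tensor and its
   covariant derivatives, with real coefficients: built from the metric, the
   Riemann tensor and the Levi-Civita tensor by sums, tensor products,
   covariant derivatives, permutations of indices and metric contractions. *)
Inductive curvature_poly : nat -> Type :=
  | CPconst : R -> curvature_poly 0
  | CPmetric : curvature_poly 2
  | CPriemann : curvature_poly 4
  | CPlevi_civita : curvature_poly D
  | CPadd k : curvature_poly k -> curvature_poly k -> curvature_poly k
  | CPmul m n : curvature_poly m -> curvature_poly n -> curvature_poly (m + n)
  | CPpermute k : 'S_k -> curvature_poly k -> curvature_poly k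
  | CPcontract k : curvature_poly k.+2 -> curvature_poly k
  | CPnabla k : curvature_poly k -> curvature_poly k.+1.

Definition contract (g : tensor_field 2) (k : nat) (T : tensor_field k.+2) : tensor_field k :=
  fun c x I => \sum_(a < D) \sum_(b < D)
    inverse_metric g c x a b * T c x [tuple of a :: b :: I].

Definition tensor_mul (m n : nat) (S : tensor_field m) (T : tensor_field n) :
  tensor_field (m + n) :=
  fun c x I => S c x [tuple tnth I (lshift n r) | r < m] *
               T c x [tuple tnth I (rshift m r) | r < n].

Fixpoint curvature_eval (g : tensor_field 2) (eps : tensor_field D) (k : nat)
    (E : curvature_poly k) : tensor_field k :=
  match E in curvature_poly k return tensor_field k with
  | CPconst a => fun _ _ _ => a
  | CPmetric => g
  | CPriemann => riemann g
  | CPlevi_civita => eps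
  | CPadd _ E1 E2 => fun c x I =>
      curvature_eval g eps E1 c x I + curvature_eval g eps E2 c x I
  | CPmul _ _ E1 E2 =>
      tensor_mul (curvature_eval g eps E1) (curvature_eval g eps E2)
  | CPpermute _ s E1 => fun c x I =>
      curvature_eval g eps E1 c x (permute_index s I)
  | CPcontract _ E1 => contract g (curvature_eval g eps E1)
  | CPnabla _ E1 => nabla g (curvature_eval g eps E1)
  end.

Fixpoint mentions_levi_civita (k : nat) (E : curvature_poly k) : bool :=
  match E with
  | CPconst _ | CPmetric | CPriemann => false
  | CPlevi_civita => true
  | CPadd _ E1 E2 => mentions_levi_civita E1 || mentions_levi_civita E2
  | CPmul _ _ E1 E2 => mentions_levi_civita E1 || mentions_levi_civita E2
  | CPpermute _ _ E1 | CPcontract _ E1 | CPnabla _ E1 =>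
      mentions_levi_civita E1
  end.

Definition stress_energy (g : tensor_field 2) (V : R -> R) (phi : M -> R) :
  tensor_field 2 :=
  fun c x I =>
    let dphi a := nabla g (scalar_field phi) c x [tuple a] in
    dphi (tnth I ord0) * dphi (tnth I ord_max) -
    (2^-1 * (\sum_(a < D) \sum_(b < D)
               inverse_metric g c x a b * dphi a * dphi b) +
     V (phi (cinv c x))) * g c x I.

(* E_ab = 8 pi T_ab; [eps] is irrelevant unless [E] mentions it. *)
Definition gravitational_field_equation (A : set chart) (g : tensor_field 2)
    (eps : tensor_field D) (E : curvature_poly 2) (V : R -> R) (phi : M -> R) :
  Prop :=
  (mentions_levi_civita E -> is_levi_civita A g eps) /\
  forall c x, A c -> cimg c x -> forall I : 2.-tuple 'I_D,
    curvature_eval g eps E c x I = 8 * pi * stress_energy g V phi c x I.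

Definition killing (A : set chart) (g : tensor_field 2) (xi : vector_field) :
  Prop :=
  is_vector A xi /\ forall p, vanishes_at A (lie xi g) p.

End Lorentzian.

(* Main.v *)
(* Write f for the Lie derivative of phi along the Killing field xi.  A Killing
   field preserves the Levi-Civita connection: the Lie derivative of Gamma is a
   tensor L_{aij}, symmetric in (a, i) because the connection is torsion-free and
   antisymmetric in (i, j) because it is metric, hence zero.  So the Lie derivative
   kills every polynomial in the curvature, and therefore T_{ab}:

     d_a phi d_b f + d_a f d_b phi = (g(dphi, df) + V'(phi) f) g_{ab}.

   If V'(phi) f were nonzero, contracting with dphi and with df would make dphi
   proportional to df, so the left-hand side would have rank at most one, while
   g has rank D >= 2.  If V'(phi) = 0 on an open set and g(dphi, df) <> 0 at a
   point, contracting with dphi shows that dphi is null near this point;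
   differentiating g(dphi, dphi) = 0 along xi gives g(dphi, df) = 0, which is
   absurd.  Hence dphi or df vanishes at each point, and where df <> 0, dphi = 0
   nearby forces f = xi(phi) = 0 nearby, so that df = 0.  Finally, if df = 0 then
   phi is an affine function of the parameter along each orbit, and its slope f is
   zero if phi is bounded. *)
From HB Require Import structures.
Require Import Defs.
From mathcomp Require Import all_boot all_order all_algebra perm.
From mathcomp Require Import all_classical all_reals all_analysis.
From mathcomp Require Import ring lra.
Import Order.TTheory GRing.Theory Num.Theory.
Import numFieldNormedType.Exports.
Local Open Scope classical_set_scope.
Local Open Scope ring_scope.

Set Implicit Arguments.
Unset Strict Implicit.
Unset Printing Implicit Defensive.

(** * Smooth functions of several variables *)

(** In a chart both derivatives of a covariant tensor are a first-order derivation plus a matrix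
    acting on every index: L_xi = xi^a d_a + [act B] with B = (d_i xi^a), and nabla_a = d_a -
    [act (Gam a)]. Commuting the two, once the slot of the derivative index is accounted for, leaves
    only the action of one matrix, the Lie derivative of Gamma, whatever the rank. Tensor identities
    thus become identities between noncommuting matrices, settled by [mx_ring]. Three constructions
    need an argument of their own: Riemann is made from derivatives of Gamma rather than from a
    tensor, so its invariance comes from differentiating that of Gamma; contraction involves the
    inverse metric; the Levi-Civita tensor is known only through its antisymmetry and the absolute
    value of one component. The potential V is merely differentiable, so T_{ab} is not known
    beforehand to be smooth and its potential term is differentiated separately. Partial derivatives
    are directional derivatives, so the symmetry of mixed ones and the chain rule rest on mean value
    estimates. *)

Lemma differentiable_of_increment (K : realType) (V W : normedModType K)
    (f : V -> W) (L : {linear V -> W}) (x : V) : continuous L ->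
  (forall e, 0 < e -> \forall v \near (0 : V),
    `|f (v + x) - (f x + L v)| <= e * `|v|) ->
  differentiable f x.
Proof.
move=> Lc fL.
have Lo : f \o shift x = cst (f x) + L +o_ 0 id by apply/eqaddoP.
have E := diff_unique Lc Lo.
by apply/diff_locallyP; rewrite E.
Qed.

Section Calculus.
Context {R : realType} {D : nat}.
Implicit Types (U : set 'rV[R]_D) (f g : 'rV[R]_D -> R) (x y : 'rV[R]_D).

Lemma near_open_eq U f g x : open U -> U x -> (forall y, U y -> f y = g y) ->
  {near x, f =1 g}.
Proof.
move=> Uo Ux fg; have : nbhs x U by exact: open_nbhs_nbhs.
by apply: filterS => y /fg.
Qed.

Lemma continuous_near_eq f g x : {near x, f =1 g} ->
  {for x, continuous f} -> {for x, continuous g}.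
Proof.
move=> fg; rewrite /prop_for /continuous_at -(nbhs_singleton fg).
by move=> fx; apply: (cvg_trans _ fx); apply: (@near_eq_cvg _ _ _ (nbhs_filter x) _ _ fg).
Qed.

Lemma pd_eq_on U f g x i : open U -> U x -> (forall y, U y -> f y = g y) ->
  pd i f x = pd i g x.
Proof. by move=> Uo Ux fg; apply/near_eq_derive/(near_open_eq Uo Ux fg). Qed.

Lemma pd_cst i (a : R) (x : 'rV[R]_D) : pd i (fun=> a) x = 0.
Proof. exact: derive_cst. Qed.

Lemma Ck_on_eq U k f g : open U -> (forall y, U y -> f y = g y) ->
  Ck_on k U f -> Ck_on k U g.
Proof.
move=> Uo; elim: k f g => [|k IH] f g fg /= [fc fd].
  by split=> // x Ux; apply: continuous_near_eq (near_open_eq Uo Ux fg) (fc x Ux).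
split; first by move=> x Ux; apply: continuous_near_eq (near_open_eq Uo Ux fg) (fc x Ux).
move=> i; have [dfi Ci] := fd i; split.
    move=> x Ux; exact: near_eq_derivable (near_open_eq Uo Ux fg) (dfi x Ux).
  by apply: IH Ci => y Uy; apply: pd_eq_on Uo Uy fg.
Qed.

Lemma Ck_on_cont U k f x : Ck_on k U f -> U x -> {for x, continuous f}.
Proof. by move=> Cf Ux; case: k Cf => [|k] [fc _]; exact: fc. Qed.

Lemma Ck_onW U k f : Ck_on k.+1 U f -> Ck_on k U f.
Proof.
elim: k f => [|k IH] f [fc fd]; first by split.
by split=> // i; have [dfi /IH] := fd i.
Qed.

Lemma Ck_on_cst U k (a : R) : Ck_on k U (fun=> a).
Proof.
elim: k a => [|k IH] a; split=> //; try by move=> x _; apply: cst_continuous.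
move=> i; split=> [x _|]; first exact: (derivable_cst a x).
by rewrite (_ : pd i _ = fun=> 0) //; apply/funext => x; exact: pd_cst.
Qed.

Lemma Ck_onD U k f g : open U -> Ck_on k U f -> Ck_on k U g ->
  Ck_on k U (fun y => f y + g y).
Proof.
move=> Uo; elim: k f g => [|k IH] f g [fc fd] [gc gd]; split=> //.
- by move=> x Ux; apply: continuousD; [exact: fc|exact: gc].
- by move=> x Ux; apply: continuousD; [exact: fc|exact: gc].
move=> i; have [dfi Cfi] := fd i; have [dgi Cgi] := gd i; split.
  by move=> x Ux; apply: derivableD; [exact: dfi|exact: dgi].
apply: Ck_on_eq (IH _ _ Cfi Cgi) => // y Uy.
by rewrite /pd -deriveD //; [exact: dfi|exact: dgi].
Qed.

Lemma Ck_onM U k f g : open U -> Ck_on k U f -> Ck_on k U g ->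
  Ck_on k U (fun y => f y * g y).
Proof.
move=> Uo; elim: k f g => [|k IH] f g.
  by move=> [fc _] [gc _]; split=> // x Ux; apply: continuousM; [exact: fc|exact: gc].
move=> Cf Cg; have [fc fd] := Cf; have [gc gd] := Cg; split.
  by move=> x Ux; apply: continuousM; [exact: fc|exact: gc].
move=> i; have [dfi Cfi] := fd i; have [dgi Cgi] := gd i; split.
  by move=> x Ux; apply: derivableM; [exact: dfi|exact: dgi].
apply: Ck_on_eq (Ck_onD Uo (IH _ _ (Ck_onW Cf) Cgi)
                           (IH _ _ (Ck_onW Cg) Cfi)) => // y Uy.
by rewrite /pd deriveM //; [exact: dfi|exact: dgi].
Qed.

Lemma Ck_onV U k f : open U -> (forall x, U x -> f x != 0) -> Ck_on k U f ->
  Ck_on k U (fun y => (f y)^-1).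
Proof.
move=> Uo f0; elim: k => [|k IH] Cf; have [fc fd] := Cf.
  by split=> // x Ux; apply: continuousV; [exact: f0|exact: fc].
split; first by move=> x Ux; apply: continuousV; [exact: f0|exact: fc].
move=> i; have [dfi Cfi] := fd i; split.
  by move=> x Ux; apply: derivableV; [exact: f0|exact: dfi].
have Cv := IH (Ck_onW Cf).
(* The derivative of 1/f is -(1/f)(1/f) d_i f, and 1/f is C^k by induction. *)
apply: Ck_on_eq (Ck_onM Uo (Ck_onM Uo (Ck_on_cst U k (-1)) (Ck_onM Uo Cv Cv)) Cfi) => //.
move=> y Uy; rewrite /pd deriveV //; [|exact: f0|exact: dfi].
by rewrite mulN1r -invfM -expr2.
Qed.

Lemma smooth_eq U f g : open U -> (forall y, U y -> f y = g y) ->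
  smooth_on U f -> smooth_on U g.
Proof. by move=> Uo fg sf k; apply: Ck_on_eq (sf k). Qed.

Lemma smooth_cont U f x : smooth_on U f -> U x -> {for x, continuous f}.
Proof. by move=> sf Ux; exact: Ck_on_cont (sf 0%N) Ux. Qed.

Lemma smooth_neq0_near U f x : smooth_on U f -> U x -> f x != 0 ->
  \forall z \near x, f z != 0.
Proof.
move=> sf Ux fx0; have fc : {for x, continuous f} := smooth_cont sf Ux.
exact: cvgr_neq0 fc fx0.
Qed.

Lemma near_open (P : set 'rV[R]_D) x : (\forall z \near x, P z) ->
  exists W, [/\ open W, W x & forall z, W z -> P z].
Proof.
move=> Px; have : nbhs x P := Px.
by rewrite nbhsE => -[W [Wo Wx] WP]; exists W.
Qed.

Lemma smooth_derivable U f x i : smooth_on U f -> U x ->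
  derivable f x (delta_mx 0 i).
Proof. by move=> sf Ux; have [_ /(_ i)[df _]] := sf 1%N; exact: df. Qed.

Lemma smooth_pd U f i : smooth_on U f -> smooth_on U (pd i f).
Proof. by move=> sf k; have [_ /(_ i)[]] := sf k.+1. Qed.

Lemma smooth_cst U (a : R) : smooth_on U (fun=> a).
Proof. by move=> k; exact: Ck_on_cst. Qed.

Lemma smoothD U f g : open U -> smooth_on U f -> smooth_on U g ->
  smooth_on U (fun y => f y + g y).
Proof. by move=> Uo sf sg k; apply: Ck_onD. Qed.

Lemma smoothM U f g : open U -> smooth_on U f -> smooth_on U g ->
  smooth_on U (fun y => f y * g y).
Proof. by move=> Uo sf sg k; apply: Ck_onM. Qed.

Lemma smoothN U f : open U -> smooth_on U f -> smooth_on U (fun y => - f y).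
Proof.
move=> Uo sf; apply: smooth_eq (smoothM Uo (smooth_cst U (-1)) sf) => // y _.
by rewrite mulN1r.
Qed.

Lemma smoothB U f g : open U -> smooth_on U f -> smooth_on U g ->
  smooth_on U (fun y => f y - g y).
Proof. by move=> Uo sf sg; apply: smoothD => //; apply: smoothN. Qed.

Lemma smoothV U f : open U -> (forall x, U x -> f x != 0) -> smooth_on U f ->
  smooth_on U (fun y => (f y)^-1).
Proof. by move=> Uo f0 sf k; apply: Ck_onV. Qed.

Lemma smooth_sum U I (r : seq I) (P : pred I) (F : I -> 'rV[R]_D -> R) :
  open U -> (forall i, P i -> smooth_on U (F i)) ->
  smooth_on U (fun y => \sum_(i <- r | P i) F i y).
Proof.
move=> Uo sF; elim: r => [|j r IH].
  by apply: smooth_eq (smooth_cst U 0) => // y _; rewrite big_nil.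
case Pj: (P j); last first.
  by apply: smooth_eq IH => // y _; rewrite big_cons Pj.
apply: smooth_eq (smoothD Uo (sF j Pj) IH) => // y _.
by rewrite big_cons Pj.
Qed.

Lemma smooth_prod U I (r : seq I) (P : pred I) (F : I -> 'rV[R]_D -> R) :
  open U -> (forall i, P i -> smooth_on U (F i)) ->
  smooth_on U (fun y => \prod_(i <- r | P i) F i y).
Proof.
move=> Uo sF; elim: r => [|j r IH].
  by apply: smooth_eq (smooth_cst U 1) => // y _; rewrite big_nil.
case Pj: (P j); last first.
  by apply: smooth_eq IH => // y _; rewrite big_cons Pj.
apply: smooth_eq (smoothM Uo (sF j Pj) IH) => // y _.
by rewrite big_cons Pj.
Qed.

Lemma pdD U f g x i : smooth_on U f -> smooth_on U g -> U x ->
  pd i (fun y => f y + g y) x = pd i f x + pd i g x.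
Proof.
move=> sf sg Ux; rewrite /pd -deriveD //; exact: smooth_derivable Ux.
Qed.

Lemma pdM U f g x i : smooth_on U f -> smooth_on U g -> U x ->
  pd i (fun y => f y * g y) x = pd i f x * g x + f x * pd i g x.
Proof.
move=> sf sg Ux; rewrite /pd [LHS]deriveM; [|exact: smooth_derivable Ux..].
by rewrite addrC; congr (_ + _); rewrite mulrC.
Qed.

Lemma pd_sum U I (r : seq I) (P : pred I) (F : I -> 'rV[R]_D -> R) x i :
  open U -> (forall j, P j -> smooth_on U (F j)) -> U x ->
  pd i (fun y => \sum_(j <- r | P j) F j y) x = \sum_(j <- r | P j) pd i (F j) x.
Proof.
move=> Uo sF Ux; elim: r => [|j r IH].
  rewrite big_nil; transitivity (pd i (fun=> 0) x); last exact: pd_cst.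
  by apply: (pd_eq_on _ Uo Ux) => y _; rewrite big_nil.
rewrite big_cons -IH; case Pj: (P j).
  rewrite -(pdD _ (sF j Pj) _ Ux); last exact: smooth_sum.
  by apply: (pd_eq_on _ Uo Ux) => y _; rewrite big_cons Pj.
by apply: (pd_eq_on _ Uo Ux) => y _; rewrite big_cons Pj.
Qed.

Lemma norm_delta_mx_le i : `|delta_mx 0 i : 'rV[R]_D| <= 1.
Proof.
rewrite /Num.Def.normr/= mx_normrE bigmax_le // => -[a b] _ /=.
by rewrite mxE normr_nat; case: (_ && _).
Qed.

(** The restriction of [f] to a coordinate line has derivative [pd i f], so the one-variable mean
    value theorem applies; the bound on [|t|] serves both signs of [s]. *)
Lemma line_MVT f (y : 'rV[R]_D) i (s : R) :
  (forall t : R, `|t| <= `|s| -> derivable f (y + t *: delta_mx 0 i) (delta_mx 0 i)) ->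
  exists2 t : R, `|t| <= `|s| &
    f (y + s *: delta_mx 0 i) - f y = s * pd i f (y + t *: delta_mx 0 i).
Proof.
set e := delta_mx 0 i => df.
pose h (t : R) := f (y + t *: e).
have dh (t : R) : `|t| <= `|s| -> is_derive t 1 h (pd i f (y + t *: e)).
  move=> ts; have dft := df t ts.
  have E : (fun r : R => h (r *: (1 : R) + t)) = (fun r : R => f (r *: e + (y + t *: e))).
    apply/funext => r; rewrite /h; congr f.
    by rewrite [_%:A]mulr1 scalerDl addrCA.
  apply: DeriveDef.
    by apply: (derivable1P h t (1 : R)).2; rewrite E; exact: (derivable1P _ _ _).1 dft.
  rewrite /pd /derive; set d := (fun _ => _); set d' := (fun _ => _).
  suff -> : d = d' by []; apply/funext => r; rewrite /d /d' /=.
  congr (_ *: (_ - _)); rewrite /h; congr f.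
  by rewrite [_%:A]mulr1 scalerDl addrCA.
have hc (a b : R) : (forall t, t \in `[a, b]%R -> `|t| <= `|s|) ->
    {within `[a, b], continuous h}.
  move=> ab; apply: derivable_within_continuous => t /ab ts.
  by case: (dh t ts).
have [s0|s0|<-] := ltgtP 0 s; last first.
- by exists 0; rewrite // scale0r addr0 mul0r subrr.
- have ab (t : R) : t \in `[s, 0]%R -> `|t| <= `|s|.
    rewrite in_itv /= => /andP[st t0].
    by rewrite (ler0_norm t0) (ltr0_norm s0) lerN2.
  have dh' (t : R) : t \in `]s, 0[%R -> is_derive t 1 h (pd i f (y + t *: e)).
    move=> tI; apply: dh; apply: ab; exact: subset_itv_oo_cc.
  have [c cI E] := MVT s0 dh' (hc _ _ ab).
  exists c; first by apply/ab/subset_itv_oo_cc.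
  move: E; rewrite /h scale0r addr0 => E.
  by rewrite -opprB E; ring.
- have ab (t : R) : t \in `[0, s]%R -> `|t| <= `|s|.
    rewrite in_itv /= => /andP[t0 st].
    by rewrite (ger0_norm t0) (gtr0_norm s0).
  have dh' (t : R) : t \in `]0, s[%R -> is_derive t 1 h (pd i f (y + t *: e)).
    move=> tI; apply: dh; apply: ab; exact: subset_itv_oo_cc.
  have [c cI E] := MVT s0 dh' (hc _ _ ab).
  exists c; first by apply/ab/subset_itv_oo_cc.
  move: E; rewrite /h scale0r addr0 => ->.
  by ring.
Qed.

Lemma dist_lt_half (a b c e : R) :
  `|a - c| < e / 2 -> `|b - c| < e / 2 -> `|a - b| <= e.
Proof.
move=> A1 A2; rewrite (le_trans (ler_distD c _ _)) //.
by rewrite [leRHS]splitr ltW // ltrD // distrC.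
Qed.

(* The second difference of [f] over a square of side [h] is [h ^ 2] times
   either mixed derivative, each at some point of the square. *)
Lemma pd_comm U f x i j : open U -> Ck_on 2 U f -> U x ->
  pd i (pd j f) x = pd j (pd i f) x.
Proof.
move=> Uo Cf Ux.
have key (a b : 'I_D) (r : R) : (forall z, `|x - z| < r -> U z) ->
    forall h : R, 0 < h -> h *+ 2 < r -> exists2 z, `|x - z| <= h *+ 2 &
    f (x + h *: delta_mx 0 a + h *: delta_mx 0 b) - f (x + h *: delta_mx 0 a)
    - (f (x + h *: delta_mx 0 b) - f x) = h * (h * pd b (pd a f) z).
  move=> rU h h0 hr.
  set ea := delta_mx 0 a; set eb := delta_mx 0 b.
  have est (t u : R) : `|t| <= `|h| -> `|u| <= `|h| ->
      `|x - (x + t *: ea + u *: eb)| <= h *+ 2.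
    move=> th uh; rewrite -addrA opprD addNKr normrN (le_trans (ler_normD _ _)) //.
    rewrite !normrZ mulr2n -(gtr0_norm h0); apply: lerD.
      by rewrite -[leRHS]mulr1 ler_pM // norm_delta_mx_le.
    by rewrite -[leRHS]mulr1 ler_pM // norm_delta_mx_le.
  have inU (t u : R) : `|t| <= `|h| -> `|u| <= `|h| -> U (x + t *: ea + u *: eb).
    by move=> th uh; apply: rU; apply: le_lt_trans hr; exact: est.
  have [_ /(_ a)[da [_ /(_ b)[dba _]]]] := Cf.
  (* The second difference is an increment of [F] along [a]. The mean value theorem turns it into an
     increment of [pd a f] along [b], to which it applies again. *)
  pose F y := f (y + h *: eb) - f y.
  have shd v y w : derivable f (y + v) w -> derivable (fun z => f (z + v)) y w.
    move=> /(derivable1P _ _ _).1 d; apply: (derivable1P _ _ _).2.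
    by rewrite (_ : (fun _ => _) = (fun t => f (t *: w + (y + v)))) //;
       apply/funext => t; rewrite addrA.
  have shD v y w : 'D_w (fun z => f (z + v)) y = 'D_w f (y + v).
    rewrite /derive; set d := (fun _ => _); set d' := (fun _ => _).
    by suff -> : d = d' by []; apply/funext => t; rewrite /d /d' /= addrA.
  have U1 (t : R) : `|t| <= `|h| -> U (x + t *: ea).
    by move=> th; have := inU t 0 th; rewrite normr0 scale0r addr0; apply.
  have [|t th E] := @line_MVT F x a h.
    move=> t th; apply: derivableB.
      by apply: shd; apply: da; apply: inU.
    by apply: da; apply: U1.
  have [|u uh E'] := @line_MVT (pd a f) (x + t *: ea) b h.
    by move=> u uh; apply: dba; apply: inU.
  exists (x + t *: ea + u *: eb); first exact: est.
  rewrite -E' -/ea -/eb; move: E; rewrite /F -/ea => ->; congr (_ * _).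
  rewrite /pd [LHS]deriveB ?shD //; first by apply: shd; apply: da; apply: inU.
  by apply: da; apply: U1.
have [r r0 rU] : exists2 r : R, 0 < r & forall z, `|x - z| < r -> U z.
  have /nbhs_ballP[r /= r0 rU] : nbhs x U by exact: open_nbhs_nbhs.
  by exists r => // z xz; apply: rU; rewrite -ball_normE.
have cont a b : {for x, continuous (pd a (pd b f))}.
  have [_ /(_ b)[_ [_ /(_ a)[_ [c _]]]]] := Cf.
  exact: c.
apply/eqP; rewrite -subr_eq0 -normr_le0; apply/ler_addgt0Pl => e e0.
rewrite addr0; have e2 : 0 < e / 2 by rewrite divr_gt0.
have /cvgrPdist_lt/(_ _ e2)/nbhs_ballP[r1 /= r10 H1] := cont i j.
have /cvgrPdist_lt/(_ _ e2)/nbhs_ballP[r2 /= r20 H2] := cont j i.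
pose h := Num.min r (Num.min r1 r2) / 4.
have m0 : 0 < Num.min r (Num.min r1 r2) by rewrite !lt_min r0 r10 r20.
have h0 : 0 < h by rewrite divr_gt0.
have hm : h *+ 2 < Num.min r (Num.min r1 r2).
  rewrite /h; move: m0; set m := Num.min _ _ => m0; lra.
have [hr hr1 hr2] : [/\ h *+ 2 < r, h *+ 2 < r1 & h *+ 2 < r2].
  by move: hm; rewrite !lt_min => /andP[-> /andP[-> ->]].
have [z1 z1h E1] := key j i r rU h h0 hr.
have [z2 z2h E2] := key i j r rU h h0 hr.
(* Exchanging i and j only swaps the two middle terms of the second difference, so both mixed
   derivatives express the same number. *)
have E : pd i (pd j f) z1 = pd j (pd i f) z2.
  apply: (mulfI (lt0r_neq0 h0)); apply: (mulfI (lt0r_neq0 h0)).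
  apply: etrans (esym E1) (etrans _ E2); rewrite (addrAC x (h *: delta_mx 0 i)).
  move: (f (x + _ + _)) (f (x + h *: delta_mx 0 j)) (f (x + h *: delta_mx 0 i)).
  by move=> p q q'; rewrite !opprD !opprK !addrA (addrAC p).
have := H1 z1; rewrite -ball_normE /= => /(_ (le_lt_trans z1h hr1)) A1.
have := H2 z2; rewrite -ball_normE /= => /(_ (le_lt_trans z2h hr2)) A2.
have {}A1 := eq_ind _ (fun w => `|pd i (pd j f) x - w| < e / 2) A1 _ E.
exact: dist_lt_half A1 A2.
Qed.

Lemma smooth_pd_comm U f x i j : open U -> smooth_on U f -> U x ->
  pd i (pd j f) x = pd j (pd i f) x.
Proof. by move=> Uo sf Ux; apply: (pd_comm _ _ Uo (sf _) Ux). Qed.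

Lemma coord_norm_le (v : 'rV[R]_D) i : `|v 0 i| <= `|v|.
Proof.
by rewrite [leRHS]/Num.Def.normr/= mx_normrE; exact: (le_bigmax _ _ (0, i)).
Qed.

(** The path from x to v + x changes one coordinate at a time. By the mean value theorem each leg
    contributes [v 0 i] times the partial derivative at an intermediate point, off by at most d|v|;
    with d = e/(D+1) the D errors stay below e|v|, and nothing is divided by zero when D = 0. *)
Lemma C1_increment U f x (e : R) : open U -> Ck_on 1 U f -> U x -> 0 < e ->
  \forall v \near (0 : 'rV[R]_D),
    `|f (v + x) - (f x + \sum_i v 0 i * pd i f x)| <= e * `|v|.
Proof.
move=> Uo [_ Cf] Ux e0; pose d := e / D.+1%:R.
have d0 : 0 < d by rewrite divr_gt0.
have : \forall z \near x, U z /\ forall i : 'I_D, `|pd i f x - pd i f z| < d.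
  apply: filterI; first exact: open_nbhs_nbhs.
  apply: (@filter_forall _ _ (fun i z => `|pd i f x - pd i f z| < d) (nbhs x)) => i.
  have [_ [ci _]] := Cf i.
  by have /cvgrPdist_lt/(_ _ d0) := ci x Ux.
move=> /nbhs_ballP[r /= r0 rU].
(* An intermediate point is at distance at most (D+1)|v| from x: at most D completed legs and a
   partial one. *)
have r'0 : 0 < r / D.+1%:R by rewrite divr_gt0.
near=> v.
have vr : `|v| < r / D.+1%:R.
  near: v; apply/nbhs_ballP; exists (r / D.+1%:R) => //= z.
  by rewrite -ball_normE /= sub0r normrN.
pose S (s : seq 'I_D) := \sum_(i <- s) v 0 i *: (delta_mx 0 i : 'rV[R]_D).
have term (i : 'I_D) (t : R) : `|t| <= `|v| ->
    `|t *: (delta_mx 0 i : 'rV[R]_D)| <= `|v|.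
  move=> tv; rewrite normrZ -[leRHS]mulr1 ler_pM //.
  exact: norm_delta_mx_le.
have SN s : `|S s| <= (size s)%:R * `|v|.
  rewrite /S; elim: s => [|i s IH]; first by rewrite big_nil normr0 mul0r.
  rewrite big_cons (le_trans (ler_normD _ _)) //= -natr1 mulrDl mul1r addrC.
  by rewrite lerD // term // coord_norm_le.
have pt s i (t : R) : (size s < D)%N -> `|t| <= `|v| ->
    ball x r (S s + x + t *: delta_mx 0 i).
  move=> sD tv; rewrite -ball_normE /= (addrC (S s)) -addrA opprD addNKr normrN.
  rewrite (le_lt_trans (ler_normD _ _)) //.
  have : `|S s| + `|t *: (delta_mx 0 i : 'rV[R]_D)| <= D.+1%:R * `|v|.
    rewrite -natr1 mulrDl mul1r lerD ?term // (le_trans (SN s)) //.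
    by rewrite ler_wpM2r // ler_nat ltnW.
  by move/le_lt_trans; apply; rewrite mulrC -ltr_pdivlMr.
have main s : (size s <= D)%N ->
    `|f (S s + x) - (f x + \sum_(i <- s) v 0 i * pd i f x)| <=
    d * (size s)%:R * `|v|.
  elim: s => [|i s IH] /= sD.
    by rewrite /S !big_nil add0r addr0 subrr normr0 mulr0 mul0r.
  have [|t tv E] := @line_MVT f (S s + x) i (v 0 i).
    move=> t tv; have [] := rU (S s + x + t *: delta_mx 0 i).
      by apply: pt => //; rewrite (le_trans tv) // coord_norm_le.
    by move=> Ut _; have [+ _] := Cf i; apply.
  have tv' : `|t| <= `|v| by rewrite (le_trans tv) // coord_norm_le.
  have [_ /(_ i) close] := rU _ (pt s i t sD tv').
  have -> : S (i :: s) + x = S s + x + v 0 i *: delta_mx 0 i.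
    by rewrite /S big_cons -addrA addrC.
  move: E => /eqP; rewrite subr_eq => /eqP ->; rewrite big_cons.
  move: (IH (ltnW sD)); set a := f (S s + x); set b := \sum_(j <- s) _.
  rewrite -natr1.
  move: (f x) (pd i f x) (pd i f (S s + x + _)) close => p q q' close.
  clearbody a b => B.
  have -> : v 0 i * q' + a - (p + (v 0 i * q + b)) =
            (a - (p + b)) - v 0 i * (q - q') by ring.
  rewrite (le_trans (ler_normB _ _)) //.
  rewrite [leRHS](_ : _ = d * (size s)%:R * `|v| + d * `|v|); last by ring.
  rewrite lerD //.
  by rewrite normrM mulrC ler_pM // ?coord_norm_le // ltW.
have E : S (index_enum 'I_D) = v.
  by rewrite [RHS]row_sum_delta.
have sz : size (index_enum 'I_D) = D.
  by rewrite -[RHS]card_ord cardE enumT.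
have := main (index_enum 'I_D); rewrite E sz leqnn => /(_ isT)/le_trans; apply.
rewrite ler_wpM2r // /d mulrAC ler_pdivrMr //.
by rewrite ler_wpM2l ?ler_nat // ltW.
Unshelve. all: by end_near. Qed.

(** The chain rule needs total differentiability, which existence of the partial derivatives alone
    would not give. *)
Lemma C1_differentiable U f x : open U -> Ck_on 1 U f -> U x ->
  differentiable f x.
Proof.
move=> Uo Cf Ux.
pose L (v : 'rV[R]_D) : R := \sum_i v 0 i * pd i f x.
have linL : linear L.
  move=> a u v; rewrite /L scaler_sumr -big_split /=; apply: eq_bigr => i _.
  by rewrite !mxE mulrDl -mulrA.
pose LM := GRing.isLinear.Build _ _ _ _ _ linL.
pose LL : {linear 'rV[R]_D -> R} := HB.pack L LM.
have Lc : continuous LL.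
  change (continuous (fun v : 'rV[R]_D => \sum_i v 0 i * pd i f x)).
  apply: (@continuous_big R _ +%R); first exact: add_continuous.
  move=> i _ v; have : {for v, continuous (fun u : 'rV[R]_D => u 0 i * pd i f x)}.
    by apply: continuousM; [exact: coord_continuous|exact: cst_continuous].
  exact.
apply: (differentiable_of_increment Lc) => e e0. exact: (C1_increment Uo Cf Ux e0).
Qed.

(** [V] is only differentiable, so [V \o f] need not be C^1 and the conclusion stops at first
    derivatives. *)
Lemma pd_comp_real U f (V : R -> R) x i : open U -> smooth_on U f -> U x ->
  derivable V (f x) 1 ->
  derivable (V \o f) x (delta_mx 0 i) /\
  pd i (V \o f) x = derive1 V (f x) * pd i f x.
Proof.
move=> Uo sf Ux dV.
have df : differentiable f x := C1_differentiable Uo (sf 1%N) Ux.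
have dV' : differentiable V (f x) by apply/derivable1_diffP.
have dc : differentiable (V \o f) x by apply: differentiable_comp.
split; first exact: diff_derivable.
rewrite /pd deriveE // diff_comp //= diff1E // -deriveE // [LHS]mulrC.
by [].
Qed.

(** This is the shape of the stress-energy tensor, with [h] its smooth part. The rules for smooth
    functions do not cover [V (f y)], hence a direct computation. *)
Lemma pd_sub_comp_mul U f g h (V : R -> R) x i : open U ->
  smooth_on U f -> smooth_on U g -> smooth_on U h -> U x ->
  derivable V (f x) 1 ->
  pd i (fun y => h y - V (f y) * g y) x =
  pd i h x - (derive1 V (f x) * pd i f x * g x + V (f x) * pd i g x).
Proof.
move=> Uo sf sg sh Ux dV.
have [dVf E] := pd_comp_real i Uo sf Ux dV.
have dg : derivable g x (delta_mx 0 i) by exact: smooth_derivable Ux.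
have dh : derivable h x (delta_mx 0 i) by exact: smooth_derivable Ux.
have dVg : derivable ((V \o f) * g) x (delta_mx 0 i) := derivableM dVf dg.
have -> : (fun y => h y - V (f y) * g y) = h - (V \o f) * g by apply/funext.
rewrite -E /pd (deriveB dh dVg) (deriveM dVf dg).
by congr (_ - _); rewrite addrC; congr (_ + _); exact: mulrC.
Qed.

Lemma derive_along_curve U f (c : R -> 'rV[R]_D) (dc : 'I_D -> R) (t : R) :
  open U -> Ck_on 1 U f -> U (c t) ->
  (forall i, is_derive t 1 (fun s => c s 0 i) (dc i)) ->
  is_derive t 1 (f \o c) (\sum_i dc i * pd i f (c t)).
Proof.
move=> Uo Cf Uc dci.
have df := C1_differentiable Uo Cf Uc.
have cd : derivable c t 1.
  by apply/derivable_mxP => a i; rewrite (ord1 a); case: (dci i).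
have cdiff : differentiable c t by apply/derivable1_diffP.
have fcd : differentiable (f \o c) t by apply: differentiable_comp.
apply: DeriveDef; first exact: diff_derivable.
have E : 'd c t 1 = \row_i dc i.
  rewrite -deriveE // derive_mx //; apply/rowP => i; rewrite !mxE.
  by case: (dci i).
rewrite deriveE // diff_comp //= E (row_sum_delta (\row_i dc i)) linear_sum /=.
by apply: eq_bigr => i _; rewrite linearZ /= -deriveE // mxE.
Qed.

End Calculus.

(* Otherwise unification unfolds partial derivatives taken at distinct points. *)
Local Opaque pd.

(** * Tensor components and derivations *)

Section Action.
Context {R : comNzRingType} {D : nat}.
Implicit Types (B C : 'M[R]_D).

(* The derivation induced on the components of a covariant tensor by the
   endomorphism [B] of the space of covectors. *)
Definition act k B (T : k.-tuple 'I_D -> R) (I : k.-tuple 'I_D) : R :=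
  \sum_(s < k) \sum_(a < D) B (tnth I s) a * T (subst_index I s a).

Lemma tnth_subst k (I : k.-tuple 'I_D) s a r :
  tnth (subst_index I s a) r = if r == s then a else tnth I r.
Proof. by rewrite tnth_mktuple. Qed.

Lemma subst_index_twice k (I : k.-tuple 'I_D) s a b :
  subst_index (subst_index I s a) s b = subst_index I s b.
Proof. by apply: eq_from_tnth => r; rewrite !tnth_subst; case: eqP. Qed.

Lemma subst_indexC k (I : k.-tuple 'I_D) s t a b : s != t ->
  subst_index (subst_index I s a) t b = subst_index (subst_index I t b) s a.
Proof.
move=> st; apply: eq_from_tnth => r; rewrite !tnth_subst.
by case: eqP => [->|//]; case: eqP => // E; rewrite E eqxx in st.
Qed.

Lemma eq_act k B (T T' : k.-tuple 'I_D -> R) I :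
  (forall J, T J = T' J) -> act B T I = act B T' I.
Proof.
by move=> TT; apply: eq_bigr => s _; apply: eq_bigr => a _; rewrite TT.
Qed.

Lemma actDm k B C (T : k.-tuple 'I_D -> R) I :
  act (B + C) T I = act B T I + act C T I.
Proof.
rewrite /act -big_split /=; apply: eq_bigr => s _.
by rewrite -big_split /=; apply: eq_bigr => a _; rewrite mxE mulrDl.
Qed.

Lemma actZm k a B (T : k.-tuple 'I_D -> R) I : act (a *: B) T I = a * act B T I.
Proof.
rewrite /act mulr_sumr; apply: eq_bigr => s _.
by rewrite mulr_sumr; apply: eq_bigr => b _; rewrite mxE mulrA.
Qed.

Lemma actNm k B (T : k.-tuple 'I_D -> R) I : act (- B) T I = - act B T I.
Proof. by rewrite -scaleN1r actZm mulN1r. Qed.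

Lemma act0m k (T : k.-tuple 'I_D -> R) I : act 0 T I = 0.
Proof. by rewrite -(scale0r (1%:M : 'M[R]_D)) actZm mul0r. Qed.

Lemma act_sumZm k n (F : 'I_n -> 'M[R]_D) (w : 'I_n -> R) (T : k.-tuple 'I_D -> R) I :
  act (\sum_e w e *: F e) T I = \sum_e w e * act (F e) T I.
Proof.
elim/big_rec2: _ => [|e x y _ IH]; first exact: act0m.
by rewrite actDm actZm IH.
Qed.

Lemma actDt k B (T T' : k.-tuple 'I_D -> R) I :
  act B (fun J => T J + T' J) I = act B T I + act B T' I.
Proof.
rewrite /act -big_split /=; apply: eq_bigr => s _.
by rewrite -big_split /=; apply: eq_bigr => a _; rewrite mulrDr.
Qed.

Lemma actZt k B w (T : k.-tuple 'I_D -> R) I :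
  act B (fun J => w * T J) I = w * act B T I.
Proof.
rewrite /act mulr_sumr; apply: eq_bigr => s _.
by rewrite mulr_sumr; apply: eq_bigr => b _; rewrite mulrCA.
Qed.

Lemma actNt k B (T : k.-tuple 'I_D -> R) I :
  act B (fun J => - T J) I = - act B T I.
Proof. by rewrite -mulN1r -actZt; apply: eq_act => J; rewrite mulN1r. Qed.

Lemma act_sumt k n B (F : 'I_n -> k.-tuple 'I_D -> R) I :
  act B (fun J => \sum_e F e J) I = \sum_e act B (F e) I.
Proof.
rewrite /act [RHS]exchange_big; apply: eq_bigr => s _ /=.
by rewrite [RHS]exchange_big; apply: eq_bigr => a _ /=; rewrite mulr_sumr.
Qed.

(** When both matrices hit the same slot they compose to a matrix product; on two different slots
    they commute, so those terms cancel in the difference. *)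
Lemma act_comm k B C (T : k.-tuple 'I_D -> R) I :
  act B (act C T) I - act C (act B T) I = act (B *m C - C *m B) T I.
Proof.
pose offdiag B C := \sum_(s < k) \sum_(t < k | t != s) \sum_(a < D) \sum_(b < D)
  B (tnth I s) a * (C (tnth I t) b * T (subst_index (subst_index I s a) t b)).
have E P Q : act P (act Q T) I = act (P *m Q) T I + offdiag P Q.
  rewrite /act /offdiag -big_split /=; apply: eq_bigr => s _.
  under eq_bigr do rewrite (bigD1 s) //= mulrDr tnth_subst eqxx.
  rewrite big_split /=; congr (_ + _).
    under eq_bigr do rewrite mulr_sumr.
    rewrite exchange_big; apply: eq_bigr => b _ /=.
    rewrite mxE mulr_suml; apply: eq_bigr => a _.
    by rewrite subst_index_twice mulrA.
  under eq_bigr do rewrite mulr_sumr.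
  rewrite exchange_big /=; apply: eq_bigr => t ts.
  apply: eq_bigr => a _; rewrite mulr_sumr; apply: eq_bigr => b _.
  by rewrite tnth_subst (negbTE ts).
have S P Q : offdiag P Q = offdiag Q P.
  rewrite /offdiag (exchange_big_dep predT) //=; apply: eq_bigr => s _.
  apply: eq_big => [t|t ts]; first by rewrite eq_sym.
  rewrite exchange_big; apply: eq_bigr => a _; apply: eq_bigr => b _.
  by rewrite mulrCA subst_indexC // eq_sym.
by rewrite !E (S C B) actDm actNm opprD addrACA subrr addr0.
Qed.

Lemma act_tuple0 B (T : 0.-tuple 'I_D -> R) I : act B T I = 0.
Proof. exact: big_ord0. Qed.

(** Splits off the slot of the head index; iterated down to [act_tuple0], it yields matrix formulas
    for low ranks, and it isolates the derivative index of [nabla]. *)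
Lemma act_cons k B (T : k.+1.-tuple 'I_D -> R) a (I : k.-tuple 'I_D) :
  act B T [tuple of a :: I] = \sum_e B a e * T [tuple of e :: I] +
    act B (fun J => T [tuple of a :: J]) I.
Proof.
have H e : subst_index [tuple of a :: I] ord0 e = [tuple of e :: I].
  apply: eq_from_tnth => r; rewrite tnth_subst.
  by case: (unliftP ord0 r) => [j|] -> //; rewrite !tnthS.
rewrite /act big_ord_recl; congr (_ + _).
  by apply: eq_bigr => e _; rewrite H tnth0.
apply: eq_bigr => s _; apply: eq_bigr => e _; rewrite tnthS; congr (_ * T _).
apply: eq_from_tnth => r; rewrite tnth_subst.
case: (unliftP ord0 r) => [j|] -> //.
by rewrite (inj_eq lift_inj) !tnthS tnth_subst.
Qed.

Lemma act_permute k B (T : k.-tuple 'I_D -> R) (p : 'S_k) I :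
  act B (fun J => T (permute_index p J)) I = act B T (permute_index p I).
Proof.
rewrite /act (reindex_inj (@perm_inj _ p)); apply: eq_bigr => s _.
apply: eq_bigr => a _; rewrite tnth_mktuple; congr (_ * T _).
apply: eq_from_tnth => r; rewrite tnth_mktuple !tnth_subst tnth_mktuple.
by rewrite (inj_eq perm_inj).
Qed.

Lemma act_mul m n B (S : m.-tuple 'I_D -> R) (T : n.-tuple 'I_D -> R)
    (I : (m + n).-tuple 'I_D) :
  let l (J : (m + n).-tuple 'I_D) := [tuple tnth J (lshift n r) | r < m] in
  let r (J : (m + n).-tuple 'I_D) := [tuple tnth J (rshift m r) | r < n] in
  act B (fun J => S (l J) * T (r J)) I =
  act B S (l I) * T (r I) + S (l I) * act B T (r I).
Proof.
move=> l r; rewrite /act big_split_ord /=; congr (_ + _).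
  rewrite mulr_suml; apply: eq_bigr => s _.
  rewrite mulr_suml; apply: eq_bigr => a _.
  rewrite tnth_mktuple -mulrA; congr (_ * (S _ * T _)).
    apply: eq_from_tnth => j; rewrite !(tnth_mktuple, tnth_subst).
    by rewrite (inj_eq (@lshift_inj _ _)).
  apply: eq_from_tnth => j; rewrite !(tnth_mktuple, tnth_subst).
  by rewrite eq_rlshift.
rewrite mulr_sumr; apply: eq_bigr => s _.
rewrite mulr_sumr; apply: eq_bigr => a _.
rewrite tnth_mktuple mulrCA; congr (S _ * (_ * T _)).
  apply: eq_from_tnth => j; rewrite !(tnth_mktuple, tnth_subst).
  by rewrite eq_lrshift.
apply: eq_from_tnth => j; rewrite !(tnth_mktuple, tnth_subst).
by rewrite (inj_eq (@rshift_inj _ _)).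
Qed.

End Action.

(** * Derivations at a point, and their extension to matrices of functions *)

Section Derivations.
Context {R : realType} {D : nat}.
Implicit Types (U : set 'rV[R]_D) (f g : 'rV[R]_D -> R) (x y : 'rV[R]_D).

(** Common interface of [pd a] and of a vector field at the point [x], so that the rules for sums,
    matrix products, inverses and determinants are proved once for both. *)
Record derivation_at U x (d : ('rV[R]_D -> R) -> R) : Prop := DerivationAt {
  der_eq : forall f g, (forall y, U y -> f y = g y) -> d f = d g;
  der_cst : forall a : R, d (fun=> a) = 0;
  derD : forall f g, smooth_on U f -> smooth_on U g ->
    d (fun y => f y + g y) = d f + d g;
  derM : forall f g, smooth_on U f -> smooth_on U g ->
    d (fun y => f y * g y) = d f * g x + f x * d g }.

Definition xder (X : 'rV[R]_D -> 'I_D -> R) f x : R :=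
  \sum_(a < D) X x a * pd a f x.

Lemma pd_derivation U x a : open U -> U x ->
  derivation_at U x (fun f => pd a f x).
Proof.
move=> Uo Ux; split.
- by move=> f g fg; exact: pd_eq_on Uo Ux fg.
- by move=> b; exact: pd_cst.
- by move=> f g sf sg; exact: pdD sf sg Ux.
- by move=> f g sf sg; exact: pdM sf sg Ux.
Qed.

Lemma xder_derivation U x X : open U -> U x ->
  derivation_at U x (fun f => xder X f x).
Proof.
move=> Uo Ux; split.
- by move=> f g fg; apply: eq_bigr => a _; rewrite (pd_eq_on a Uo Ux fg).
- by move=> b; apply: big1 => a _; rewrite pd_cst mulr0.
- move=> f g sf sg; rewrite /xder -big_split /=; apply: eq_bigr => a _.
  by rewrite (pdD a sf sg Ux) mulrDr.
- move=> f g sf sg; rewrite /xder mulr_suml mulr_sumr -big_split /=.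
  apply: eq_bigr => a _; rewrite (pdM a sf sg Ux) mulrDr mulrA; congr (_ + _).
  by rewrite mulrCA.
Qed.

Lemma smooth_xder U X f : open U -> (forall a, smooth_on U (fun y => X y a)) ->
  smooth_on U f -> smooth_on U (xder X f).
Proof.
move=> Uo sX sf; apply: smooth_sum => // a _; apply: smoothM => //.
exact: smooth_pd.
Qed.

(** The commutator of d_a with the vector field is (d_a X^e) d_e: the second-order terms agree by
    symmetry of mixed derivatives. *)
Lemma pd_xder U X f x a : open U -> U x ->
  (forall e, smooth_on U (fun y => X y e)) -> smooth_on U f ->
  pd a (xder X f) x =
  xder X (pd a f) x + \sum_e pd a (fun y => X y e) x * pd e f x.
Proof.
move=> Uo Ux sX sf; have spf e : smooth_on U (pd e f) by exact: smooth_pd.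
transitivity (\sum_e pd a (fun y => X y e * pd e f y) x).
  by apply: (pd_sum _ _ Uo) => // e _; apply: smoothM.
rewrite /xder -big_split /=; apply: eq_bigr => e _.
by rewrite (pdM a (sX e) (spf e) Ux) addrC (smooth_pd_comm a e Uo sf Ux).
Qed.

Section Rules.
Variables (U : set 'rV[R]_D) (x : 'rV[R]_D) (d : ('rV[R]_D -> R) -> R).
Hypotheses (Uo : open U) (Ux : U x) (dd : derivation_at U x d).

Lemma derZ f a : smooth_on U f -> d (fun y => a * f y) = a * d f.
Proof. by move=> sf; rewrite (derM dd (smooth_cst U a) sf) (der_cst dd) mul0r add0r. Qed.

Lemma derN f : smooth_on U f -> d (fun y => - f y) = - d f.
Proof.
move=> sf; rewrite -mulN1r -derZ //; apply: (der_eq dd) => y _.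
by rewrite mulN1r.
Qed.

Lemma derB f g : smooth_on U f -> smooth_on U g ->
  d (fun y => f y - g y) = d f - d g.
Proof. by move=> sf sg; rewrite (derD dd sf (smoothN Uo sg)) derN. Qed.

Lemma der_sum I (r : seq I) (P : pred I) (F : I -> 'rV[R]_D -> R) :
  (forall j, P j -> smooth_on U (F j)) ->
  d (fun y => \sum_(j <- r | P j) F j y) = \sum_(j <- r | P j) d (F j).
Proof.
move=> sF; elim: r => [|j r IH].
  rewrite big_nil; transitivity (d (fun=> 0)); last exact: der_cst dd _.
  by apply: (der_eq dd) => y _; rewrite big_nil.
rewrite big_cons -IH; case Pj: (P j).
  rewrite -(derD dd (sF j Pj)); last exact: smooth_sum.
  by apply: (der_eq dd) => y _; rewrite big_cons Pj.
by apply: (der_eq dd) => y _; rewrite big_cons Pj.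
Qed.

(** The differentiated factor is replaced in place, which is the form that a determinant with one
    row replaced requires. *)
Lemma der_prod n (F : 'I_n -> 'rV[R]_D -> R) : (forall j, smooth_on U (F j)) ->
  d (fun y => \prod_j F j y) =
  \sum_k \prod_j (if j == k then d (F j) else F j x).
Proof.
elim: n F => [|n IH] F sF.
  rewrite big_ord0; transitivity (d (fun=> 1)); last exact: der_cst dd _.
  by apply: (der_eq dd) => y _; rewrite big_ord0.
transitivity (d (fun y => F ord0 y * \prod_j F (lift ord0 j) y)).
  by apply: (der_eq dd) => y _; rewrite big_ord_recl.
rewrite (derM dd) //; last exact: smooth_prod.
rewrite IH // big_ord_recl big_ord_recl /=; congr (_ + _).
rewrite big_distrr /=; apply: eq_bigr => k _; rewrite big_ord_recl /=.
by congr (_ * _); apply: eq_bigr => j _; rewrite (inj_eq lift_inj).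
Qed.

Definition smooth_mx m n (F : 'rV[R]_D -> 'M[R]_(m, n)) : Prop :=
  forall i j, smooth_on U (fun y => F y i j).

Definition der_mx m n (F : 'rV[R]_D -> 'M[R]_(m, n)) : 'M[R]_(m, n) :=
  \matrix_(i, j) d (fun y => F y i j).

Lemma der_mx_eq m n (F G : 'rV[R]_D -> 'M[R]_(m, n)) :
  (forall y, U y -> F y = G y) -> der_mx F = der_mx G.
Proof.
move=> FG; apply/matrixP => i j; rewrite !mxE; apply: (der_eq dd) => y Uy.
by rewrite FG.
Qed.

Lemma der_mxD m n (F G : 'rV[R]_D -> 'M[R]_(m, n)) :
  smooth_mx F -> smooth_mx G ->
  der_mx (fun y => F y + G y) = der_mx F + der_mx G.
Proof.
move=> sF sG; apply/matrixP => i j; rewrite !mxE -(derD dd) //.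
by apply: (der_eq dd) => y _; rewrite mxE.
Qed.

Lemma der_mxN m n (F : 'rV[R]_D -> 'M[R]_(m, n)) :
  smooth_mx F -> der_mx (fun y => - F y) = - der_mx F.
Proof.
move=> sF; apply/matrixP => i j; rewrite !mxE -derN //.
by apply: (der_eq dd) => y _; rewrite mxE.
Qed.

Lemma der_mxT m n (F : 'rV[R]_D -> 'M[R]_(m, n)) :
  der_mx (fun y => (F y)^T) = (der_mx F)^T.
Proof.
by apply/matrixP => i j; rewrite !mxE; apply: (der_eq dd) => y _; rewrite mxE.
Qed.

Lemma der_mxM m n p (F : 'rV[R]_D -> 'M[R]_(m, n)) (G : 'rV[R]_D -> 'M[R]_(n, p)) :
  smooth_mx F -> smooth_mx G ->
  der_mx (fun y => F y *m G y) = der_mx F *m G x + F x *m der_mx G.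
Proof.
move=> sF sG; apply/matrixP => i j; rewrite !mxE -big_split /=.
transitivity (d (fun y => \sum_k F y i k * G y k j)).
  by apply: (der_eq dd) => y _; rewrite mxE.
rewrite der_sum; last by move=> k _; exact: smoothM.
by apply: eq_bigr => k _; rewrite (derM dd) // !mxE.
Qed.

Lemma der_mx_sumZ m n q (w : 'I_q -> 'rV[R]_D -> R)
    (F : 'I_q -> 'rV[R]_D -> 'M[R]_(m, n)) :
  (forall e, smooth_on U (w e)) -> (forall e, smooth_mx (F e)) ->
  der_mx (fun y => \sum_e w e y *: F e y) =
  \sum_e d (w e) *: F e x + \sum_e w e x *: der_mx (F e).
Proof.
move=> sw sF; apply/matrixP => i j; rewrite !mxE !summxE -big_split /=.
transitivity (d (fun y => \sum_e w e y * F e y i j)).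
  by apply: (der_eq dd) => y _; rewrite summxE; apply: eq_bigr => e _; rewrite mxE.
rewrite der_sum; last by move=> e _; apply: smoothM => //; apply: sF.
by apply: eq_bigr => e _; rewrite (derM dd) ?mxE //; apply: sF.
Qed.

Lemma der_act k (B : 'rV[R]_D -> 'M[R]_D) (T : 'rV[R]_D -> k.-tuple 'I_D -> R) I :
  smooth_mx B -> (forall J, smooth_on U (fun y => T y J)) ->
  d (fun y => act (B y) (T y) I) =
  act (der_mx B) (T x) I + act (B x) (fun J => d (fun y => T y J)) I.
Proof.
move=> sB sT; rewrite /act der_sum; last first.
  by move=> s _; apply: smooth_sum => // a _; apply: smoothM => //; exact: sB.
rewrite -big_split /=; apply: eq_bigr => s _; rewrite der_sum; last first.
  by move=> a _; apply: smoothM => //; exact: sB.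
rewrite -big_split /=; apply: eq_bigr => a _.
by rewrite (derM dd) ?mxE //; exact: sB.
Qed.

Lemma smooth_det n (F : 'rV[R]_D -> 'M[R]_n) : smooth_mx F ->
  smooth_on U (fun y => \det (F y)).
Proof.
move=> sF; apply: smooth_sum => // s _; apply: smoothM => //.
  exact: smooth_cst.
by apply: smooth_prod => // i _; exact: sF.
Qed.

Lemma smooth_invmx n (F : 'rV[R]_D -> 'M[R]_n) : smooth_mx F ->
  (forall y, U y -> F y \in unitmx) -> smooth_mx (fun y => invmx (F y)).
Proof.
move=> sF uF i j.
(* Cramer's formula: the inverse is polynomial in the entries, divided by the determinant. *)
apply: (@smooth_eq _ _ _ (fun y => (\det (F y))^-1 * cofactor (F y) j i)) => //.
  by move=> y Uy; rewrite /invmx uF // !mxE.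
apply: smoothM => //.
  apply: smoothV => //; last exact: smooth_det.
  by move=> y Uy; rewrite -unitfE -unitmxE uF.
rewrite /cofactor; apply: smoothM => //; first exact: smooth_cst.
apply: smooth_det => a b.
by apply: (smooth_eq Uo _ (sF (lift j a) (lift i b))) => y _; rewrite !mxE.
Qed.

Lemma der_invmx n (F : 'rV[R]_D -> 'M[R]_n) : smooth_mx F ->
  (forall y, U y -> F y \in unitmx) ->
  der_mx (fun y => invmx (F y)) = - (invmx (F x) *m der_mx F *m invmx (F x)).
Proof.
move=> sF uF; have sV := smooth_invmx sF uF.
have : der_mx (fun y => F y *m invmx (F y)) = 0.
  transitivity (der_mx (fun=> 1%:M : 'M[R]_n)).
    by apply: der_mx_eq => y Uy; rewrite mulmxV ?uF.
  by apply/matrixP => i j; rewrite !mxE; exact: der_cst dd _.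
rewrite der_mxM // addrC => /eqP; rewrite addr_eq0 => /eqP E.
rewrite -[LHS](mulKmx (uF x Ux)) E.
by rewrite mulmxN mulmxA.
Qed.

(** Jacobi's formula: the Leibniz expansion is differentiated one row at a time, and each resulting
    determinant is expanded along its differentiated row. *)
Lemma der_det n (F : 'rV[R]_D -> 'M[R]_n) : smooth_mx F ->
  d (fun y => \det (F y)) = \tr (der_mx F *m \adj (F x)).
Proof.
move=> sF; rewrite /determinant der_sum; last first.
  move=> s _; apply: smoothM => //; first exact: smooth_cst.
  by apply: smooth_prod => // i _; exact: sF.
transitivity (\sum_(s : 'S_n) \sum_k (-1) ^+ s *
    \prod_i (if i == k then der_mx F i (s i) else F x i (s i))).
  apply: eq_bigr => s _; rewrite derZ; last first.
    by apply: smooth_prod => // i _; exact: sF.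
  rewrite der_prod => [|i]; last exact: sF.
  rewrite mulr_sumr; apply: eq_bigr => k _; congr (_ * _).
  by apply: eq_bigr => i _; rewrite mxE.
rewrite exchange_big /mxtrace; apply: eq_bigr => k _ /=.
(* [F x] with row k differentiated; its cofactors along row k are those of [F x]. *)
pose G := \matrix_(i, j) (if i == k then der_mx F i j else F x i j).
transitivity (\det G).
  by apply: eq_bigr => s _; congr (_ * _); apply: eq_bigr => i _; rewrite [RHS]mxE.
rewrite (expand_det_row _ k) mxE; apply: eq_bigr => j _.
rewrite [G k j]mxE eqxx [\adj _ _ _]mxE; congr (_ * (_ * \det _)).
by apply/matrixP => a b; rewrite !mxE eq_sym (negbTE (neq_lift _ _)).
Qed.

End Rules.
End Derivations.

(** * Killing fields in a chart *)

Section MatrixIdentities.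
Context {R : comNzRingType} {n : nat}.
Implicit Types A B C : 'M[R]_n.

Lemma add_mxE A B i j : (A + B) i j = A i j + B i j.
Proof. by rewrite mxE. Qed.

Lemma opp_mxE A i j : (- A) i j = - A i j.
Proof. by rewrite mxE. Qed.

Lemma zero_mxE i j : (0 : 'M[R]_n) i j = 0.
Proof. by rewrite mxE. Qed.

Lemma trmx_add A B : (A + B)^T = A^T + B^T.
Proof. exact: raddfD. Qed.

Lemma trmx_opp A : (- A)^T = - A^T.
Proof. exact: raddfN. Qed.

Definition mx_normE := (trmx_add, trmx_opp, @trmx_mul, @trmxK, @mulmxDl, @mulmxDr,
  @mulmxBl, @mulmxBr, @mulmxN, @mulNmx, @mulmxA).

End MatrixIdentities.

(* Decides equations of noncommutative polynomials in square matrices and their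
   transposes. *)
Ltac mx_ring :=
  rewrite ?mx_normE;
  let i := fresh "i" in let j := fresh "j" in
  apply/matrixP; intros i j; rewrite ?(add_mxE, opp_mxE, zero_mxE);
  ring.

Section KillingIdentities.
Context {R : comNzRingType} {n : nat}.
Implicit Types A B C G S Q XG xG dB XQ : 'M[R]_n.

(** The left-hand side is d_a applied to X(G) + B G + G B^T, with the derivatives [XG] and [PG] of
    the metric already replaced through the Killing equation and metricity. The last term makes the
    identity hold for every [G]; it vanishes for a symmetric metric. *)
Lemma killing_derivative_identity G B Q S dB xQ :
  let XG := - (B *m G) - G *m B^T in
  let PG := Q *m G + G *m Q^T in
  let L := dB + xQ + S + (B *m Q - Q *m B) in
  (xQ *m G + Q *m XG + (XG *m Q^T + G *m xQ^T)) + (S *m G + G *m S^T) +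
  (dB *m G + B *m PG) + (PG *m B^T + G *m dB^T) =
  L *m G + (L *m G)^T + (G - G^T) *m L^T.
Proof. move=> XG PG L; rewrite /XG /PG /L; mx_ring. Qed.

(* [Gc], [Gd] are connection matrices, [Bc], [Bd] the derivatives of [B], [P]
   and [Q] the derivatives of [Gd] and [Gc], and the remaining variables are
   contractions of [B] with these. *)
Lemma curvature_invariance_identity
    B Bc Bd Gc Gd P Q H Z Sc Sd s1 s2 s3 s4 :
  let XGc := - Bc - Sc - (B *m Gc - Gc *m B) in
  let XGd := - Bd - Sd - (B *m Gd - Gd *m B) in
  let XP := - H - (Z + s3) - ((Bc *m Gd + B *m P) - (P *m B + Gd *m Bc)) - s1 in
  let XQ := - H - (Z + s2) - ((Bd *m Gc + B *m Q) - (Q *m B + Gc *m Bd)) - s4 in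
  let Rcd := P - Q + (Gd *m Gc - Gc *m Gd) in
  XP - XQ + ((XGd *m Gc + Gd *m XGc) - (XGc *m Gd + Gc *m XGd)) +
  (B *m Rcd - Rcd *m B) +
  (s1 - s2 + (Gd *m Sc - Sc *m Gd)) + (s3 - s4 + (Sd *m Gc - Gc *m Sd)) = 0.
Proof.
move=> XGc XGd XP XQ Rcd; rewrite /XGc /XGd /XP /XQ /Rcd.
mx_ring.
Qed.

End KillingIdentities.

Section LocalKilling.
Context {R : realType} {D : nat}.
Implicit Types (F : 'rV[R]_D -> 'M[R]_D) (x y : 'rV[R]_D).
Variables (U : set 'rV[R]_D) (X : 'rV[R]_D -> 'I_D -> R).
Hypotheses (Uo : open U) (sX : forall a, smooth_on U (fun y => X y a)).

Definition pd_mx a F x : 'M[R]_D := der_mx (fun f => pd a f x) F.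

Definition xder_mx F x : 'M[R]_D := der_mx (fun f => xder X f x) F.

(** The row is the derivative index: in this layout [act (vjac x)] is the algebraic part of the Lie
    derivative of a covariant tensor. *)
Definition vjac x : 'M[R]_D := \matrix_(i, a) pd i (fun y => X y a) x.

Lemma pd_mxE a F x i j : pd_mx a F x i j = pd a (fun y => F y i j) x.
Proof. by rewrite mxE. Qed.

Lemma xder_mxE F x i j : xder_mx F x i j = xder X (fun y => F y i j) x.
Proof. by rewrite mxE. Qed.

Lemma smooth_vjac : smooth_mx U vjac.
Proof.
move=> i a; apply: (smooth_eq Uo _ (smooth_pd i (sX a))) => y _.
by rewrite mxE.
Qed.

Lemma smooth_pd_mx a F : smooth_mx U F -> smooth_mx U (pd_mx a F).
Proof.
move=> sF i j; apply: (smooth_eq Uo _ (smooth_pd a (sF i j))) => y _.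
by rewrite mxE.
Qed.

Lemma smooth_mx_mul F F' : smooth_mx U F -> smooth_mx U F' ->
  smooth_mx U (fun y => F y *m F' y).
Proof.
move=> sF sF' i j.
apply: (@smooth_eq _ _ _ (fun y => \sum_k F y i k * F' y k j)) => //.
  by move=> y _; rewrite mxE.
by apply: smooth_sum => // k _; apply: smoothM; [|exact: sF|exact: sF'].
Qed.

Lemma smooth_mx_add F F' : smooth_mx U F -> smooth_mx U F' ->
  smooth_mx U (fun y => F y + F' y).
Proof.
move=> sF sF' i j; apply: (smooth_eq Uo _ (smoothD Uo (sF i j) (sF' i j))).
by move=> y _; rewrite mxE.
Qed.

Lemma smooth_mx_opp F : smooth_mx U F -> smooth_mx U (fun y => - F y).
Proof.
move=> sF i j; apply: (smooth_eq Uo _ (smoothN Uo (sF i j))).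
by move=> y _; rewrite mxE.
Qed.

Lemma smooth_mx_tr F : smooth_mx U F -> smooth_mx U (fun y => (F y)^T).
Proof.
move=> sF i j; apply: (smooth_eq Uo _ (sF j i)).
by move=> y _; rewrite mxE.
Qed.

Lemma smooth_mx_sumZ (w : 'I_D -> 'rV[R]_D -> R) (F : 'I_D -> 'rV[R]_D -> 'M[R]_D) :
  (forall e, smooth_on U (w e)) -> (forall e, smooth_mx U (F e)) ->
  smooth_mx U (fun y => \sum_e w e y *: F e y).
Proof.
move=> sw sF i j.
apply: (@smooth_eq _ _ _ (fun y => \sum_e w e y * F e y i j)) => //.
  by move=> y _; rewrite summxE; apply: eq_bigr => e _; rewrite mxE.
by apply: smooth_sum => // e _; apply: smoothM => //; apply: sF.
Qed.

Lemma pd_xder_mx a F x : U x -> smooth_mx U F ->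
  pd_mx a (xder_mx F) x =
  xder_mx (pd_mx a F) x + \sum_e vjac x a e *: pd_mx e F x.
Proof.
move=> Ux sF; apply/matrixP => i j; rewrite !mxE summxE.
transitivity (pd a (xder X (fun y => F y i j)) x).
  by apply: pd_eq_on Uo Ux _ => y _; rewrite mxE.
rewrite (pd_xder _ Uo) //; congr (_ + _).
  by apply: (der_eq (xder_derivation X Uo Ux)) => y _; rewrite mxE.
by apply: eq_bigr => e _; rewrite !mxE.
Qed.

Lemma pd_mx_comm a b F x : U x -> smooth_mx U F ->
  pd_mx a (pd_mx b F) x = pd_mx b (pd_mx a F) x.
Proof.
move=> Ux sF; apply/matrixP => i j; rewrite [LHS]pd_mxE [RHS]pd_mxE.
transitivity (pd a (pd b (fun y => F y i j)) x).
  by apply: pd_eq_on Uo Ux _ => y _; exact: pd_mxE.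
rewrite (smooth_pd_comm _ _ Uo (sF i j) Ux).
by apply: pd_eq_on Uo Ux _ => y _; rewrite pd_mxE.
Qed.

(* [Gam a y i e] is Gamma^e_{ai}, so that connection matrices act on covectors. *)
Variables (G : 'rV[R]_D -> 'M[R]_D) (Gam : 'I_D -> 'rV[R]_D -> 'M[R]_D).
Hypotheses (sG : smooth_mx U G) (sGam : forall a, smooth_mx U (Gam a)).
Hypothesis G_sym : forall y, U y -> (G y)^T = G y.
Hypothesis G_unit : forall y, U y -> G y \in unitmx.
Hypothesis torsion_free :
  forall y, U y -> forall a b e, Gam a y b e = Gam b y a e.
Hypothesis metricity : forall y, U y -> forall a,
  pd_mx a G y = Gam a y *m G y + G y *m (Gam a y)^T.
Hypothesis G_killing : forall y, U y ->
  xder_mx G y = - (vjac y *m G y) - G y *m (vjac y)^T.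

(** The entry (i, e) is the Lie derivative of Gamma^e_{ai}; the second derivatives of xi in
    [pd_mx a vjac] reflect the inhomogeneous transformation law of Gamma. *)
Definition lie_conn a x : 'M[R]_D :=
  pd_mx a vjac x + xder_mx (Gam a) x + \sum_e vjac x a e *: Gam e x +
  (vjac x *m Gam a x - Gam a x *m vjac x).

(** X(d_a G) is computed in two ways: by commuting d_a with X in the Killing equation, and by
    applying X to metricity. The result is antisymmetry in the last two indices, once lowered. *)
Lemma lie_conn_metric a x : U x ->
  lie_conn a x *m G x + (lie_conn a x *m G x)^T = 0.
Proof.
move=> Ux.
have dp := pd_derivation a Uo Ux; have dx := xder_derivation X Uo Ux.
have sB := smooth_vjac.
have GT : smooth_mx U (fun y => (vjac y)^T) := smooth_mx_tr sB.
have sBG := smooth_mx_mul sB sG.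
have sGB := smooth_mx_mul sG GT.
have : pd_mx a (xder_mx G) x =
       - (pd_mx a vjac x *m G x + vjac x *m pd_mx a G x) -
       (pd_mx a G x *m (vjac x)^T + G x *m (pd_mx a vjac x)^T).
  rewrite /pd_mx (der_mx_eq dp G_killing) (der_mxD dp); last first.
  - exact: smooth_mx_opp.
  - exact: smooth_mx_opp.
  rewrite (der_mxN dp) // (der_mxN dp) // (der_mxM Uo dp) // (der_mxM Uo dp) //.
  by rewrite (der_mxT dp).
rewrite pd_xder_mx //.
have -> : xder_mx (pd_mx a G) x =
    xder_mx (Gam a) x *m G x + Gam a x *m xder_mx G x +
    (xder_mx G x *m (Gam a x)^T + G x *m (xder_mx (Gam a) x)^T).
  have sGamT := smooth_mx_tr (sGam a).
  rewrite {1}/xder_mx (der_mx_eq dx (fun y Uy => metricity Uy a)) (der_mxD dx).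
  - by rewrite !(der_mxM Uo dx) // (der_mxT dx).
  - exact: smooth_mx_mul.
  - exact: smooth_mx_mul.
have -> : \sum_e vjac x a e *: pd_mx e G x =
    (\sum_e vjac x a e *: Gam e x) *m G x +
    G x *m (\sum_e vjac x a e *: Gam e x)^T.
  rewrite mulmx_suml linear_sum mulmx_sumr -big_split /=; apply: eq_bigr => e _.
  by rewrite metricity // scalerDr linearZ /= -scalemxAl -scalemxAr.
rewrite G_killing // metricity // => E.
have := killing_derivative_identity (G x) (vjac x) (Gam a x)
  (\sum_e vjac x a e *: Gam e x) (pd_mx a vjac x) (xder_mx (Gam a) x).
rewrite /= E G_sym // subrr mul0mx addr0 /lie_conn => <-.
by rewrite -addrA -opprD addNr.
Qed.

(** Second derivatives of xi commute and Gamma is symmetric; exchanging a and i swaps the sum over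
    [Gam e] with the product [vjac x *m Gam a x]. *)
Lemma lie_conn_sym a i e x : U x -> lie_conn a x i e = lie_conn i x a e.
Proof.
move=> Ux; rewrite /lie_conn !mxE !summxE.
have -> : pd a (fun y => vjac y i e) x = pd i (fun y => vjac y a e) x.
  transitivity (pd a (pd i (fun y => X y e)) x).
    by apply: pd_eq_on Uo Ux _ => y _; rewrite mxE.
  rewrite (smooth_pd_comm _ _ Uo (sX e) Ux).
  by apply: pd_eq_on Uo Ux _ => y _; rewrite mxE.
have -> : xder X (fun y => Gam a y i e) x = xder X (fun y => Gam i y a e) x.
  by apply: (der_eq (xder_derivation X Uo Ux)) => y Uy; exact: torsion_free.
have E b c : \sum_k (vjac x b k *: Gam k x) c e = \sum_k vjac x b k * Gam c x k e.
  by apply: eq_bigr => k _; rewrite mxE torsion_free.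
have E' : \sum_k Gam a x i k * vjac x k e = \sum_k Gam i x a k * vjac x k e.
  by apply: eq_bigr => k _; rewrite torsion_free.
rewrite !E E'; ring.
Qed.

Lemma lie_conn_eq0 a x : U x -> lie_conn a x = 0.
Proof.
move=> Ux; pose L b := lie_conn b x *m G x.
have anti b i j : L b i j = - L b j i.
  have /matrixP/(_ i j) := lie_conn_metric b Ux.
  by rewrite add_mxE zero_mxE [X in _ + X]mxE => /eqP; rewrite addr_eq0 => /eqP.
have sym b i j : L b i j = L i b j.
  by rewrite /L !mxE; apply: eq_bigr => k _; rewrite lie_conn_sym.
have L0 : L a = 0.
  apply/matrixP => i j; rewrite [RHS]mxE.
  have : L a i j = - L a i j.
    by rewrite {1}anti sym anti opprK sym anti sym.
  lra.
by rewrite -[LHS](mulmxK (G_unit Ux)) -/(L a) L0 mul0mx.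
Qed.

Lemma xder_conn a x : U x -> xder_mx (Gam a) x =
  - pd_mx a vjac x - \sum_e vjac x a e *: Gam e x -
  (vjac x *m Gam a x - Gam a x *m vjac x).
Proof.
move=> /(lie_conn_eq0 a)/eqP; rewrite /lie_conn -!addrA addrCA addr_eq0 => /eqP ->.
by rewrite !opprD !addrA.
Qed.

(* [N a J] is the component nabla_a T_J. *)
Lemma lie_covariant_derivative k (T : 'rV[R]_D -> k.-tuple 'I_D -> R) x
    (N : 'I_D -> k.-tuple 'I_D -> 'rV[R]_D -> R) :
  U x -> (forall J, smooth_on U (fun y => T y J)) ->
  (forall a J y, N a J y = pd a (fun z => T z J) y - act (Gam a y) (T y) J) ->
  (forall y J, U y -> xder X (fun z => T z J) y + act (vjac y) (T y) J = 0) ->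
  forall a J, xder X (N a J) x + \sum_e vjac x a e * N e J x +
    act (vjac x) (fun J' => N a J' x) J = 0.
Proof.
move=> Ux sT NE LT a J.
have dp := pd_derivation a Uo Ux; have dx := xder_derivation X Uo Ux.
have sB := smooth_vjac.
have sact (F : 'rV[R]_D -> 'M[R]_D) J' : smooth_mx U F ->
    smooth_on U (fun y => act (F y) (T y) J').
  move=> sF; apply: smooth_sum => // s _; apply: smooth_sum => // b _.
  by apply: smoothM => //; exact: sF.
have xT y J' : U y -> xder X (fun z => T z J') y = - act (vjac y) (T y) J'.
  by move=> Uy; apply/eqP; rewrite -addr_eq0 LT.
have E1 : xder X (N a J) x = xder X (pd a (fun z => T z J)) x -
    (act (xder_mx (Gam a) x) (T x) J - act (Gam a x) (act (vjac x) (T x)) J).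
  transitivity (xder X (fun y => pd a (fun z => T z J) y - act (Gam a y) (T y) J) x).
    by apply: (der_eq dx) => y _; exact: NE.
  rewrite (derB Uo dx); [|exact: smooth_pd|exact: sact].
  rewrite (der_act Uo dx) //; congr (_ - (_ + _)).
  by rewrite -actNt; apply: eq_act => J'; exact: xT.
have E2 : xder X (pd a (fun z => T z J)) x +
    \sum_e vjac x a e * pd e (fun z => T z J) x =
    - (act (pd_mx a vjac x) (T x) J +
       act (vjac x) (fun J' => pd a (fun z => T z J') x) J).
  have := pd_xder a Uo Ux sX (sT J).
  rewrite (_ : \sum_e _ = \sum_e vjac x a e * pd e (fun z => T z J) x); last first.
    by apply: eq_bigr => e _; rewrite mxE.
  move=> <-; rewrite (der_eq dp (fun y => @xT y J)) (derN dp); last exact: sact.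
  by rewrite (der_act Uo dp).
have E3 : \sum_e vjac x a e * N e J x =
    \sum_e vjac x a e * pd e (fun z => T z J) x -
    act (\sum_e vjac x a e *: Gam e x) (T x) J.
  rewrite act_sumZm -sumrB; apply: eq_bigr => e _.
  by rewrite NE mulrBr.
have E4 : act (vjac x) (fun J' => N a J' x) J =
    act (vjac x) (fun J' => pd a (fun z => T z J') x) J -
    act (vjac x) (act (Gam a x) (T x)) J.
  by rewrite -actNt -actDt; apply: eq_act => J'; rewrite NE.
(* By [E2] the derivatives of T cancel, and the commutator of the two actions completes the rest to
   minus the action of [lie_conn a x]. *)
rewrite E1 E3 E4.
have E5 := act_comm (vjac x) (Gam a x) (T x) J.
have E6 : act (lie_conn a x) (T x) J = 0 by rewrite lie_conn_eq0 // act0m.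
move: E6; rewrite /lie_conn actDm -E5 !actDm => E6.
move: E2 E6; lra.
Qed.

End LocalKilling.

(** [H] is the metric and [Q] the curvature, with [P] = X(Q). Inserting X(H) = - B H - H B^T turns
    the action of B on two lower slots into the commutator that belongs to one upper and one lower
    slot. *)
Lemma lowering_identity (R : comNzRingType) n (P S S' Q B H : 'M[R]_n) :
  (- (B *m H) - H *m B^T) *m Q^T + H *m P^T + B *m (H *m Q^T) +
  H *m Q^T *m B^T + H *m S^T + H *m S'^T =
  H *m (P + (B *m Q - Q *m B) + S + S')^T.
Proof. by mx_ring. Qed.

(** * Invariance of the curvature, of contraction and of the Levi-Civita tensor *)

Section InvariantTensors.
Context {R : realType} {D : nat}.
Implicit Types (F : 'rV[R]_D -> 'M[R]_D) (x y : 'rV[R]_D).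
Variables (U : set 'rV[R]_D) (X : 'rV[R]_D -> 'I_D -> R).
Hypotheses (Uo : open U) (sX : forall a, smooth_on U (fun y => X y a)).
Variables (G : 'rV[R]_D -> 'M[R]_D) (Gam : 'I_D -> 'rV[R]_D -> 'M[R]_D).
Hypotheses (sG : smooth_mx U G) (sGam : forall a, smooth_mx U (Gam a)).
Hypothesis G_unit : forall y, U y -> G y \in unitmx.
Hypothesis G_killing : forall y, U y ->
  xder_mx X G y = - (vjac X y *m G y) - G y *m (vjac X y)^T.
Hypothesis xder_conn : forall a x, U x -> xder_mx X (Gam a) x =
  - pd_mx a (vjac X) x - \sum_e vjac X x a e *: Gam e x -
  (vjac X x *m Gam a x - Gam a x *m vjac X x).

(* [curv c d x b e] is R^e_{bcd} *)
Definition curv c d y : 'M[R]_D :=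
  pd_mx c (Gam d) y - pd_mx d (Gam c) y +
  (Gam d y *m Gam c y - Gam c y *m Gam d y).

Lemma curvE c d y b e : curv c d y b e =
  pd c (fun z => Gam d z b e) y - pd d (fun z => Gam c z b e) y +
  \sum_f (Gam d y b f * Gam c y f e - Gam c y b f * Gam d y f e).
Proof.
rewrite /curv !add_mxE !opp_mxE !pd_mxE; congr (_ + _).
by rewrite ![(_ *m _) _ _]mxE -sumrB.
Qed.

Lemma smooth_curv c d : smooth_mx U (curv c d).
Proof.
apply: smooth_mx_add => //; apply: smooth_mx_add => //.
- exact: smooth_pd_mx.
- by apply: smooth_mx_opp => //; exact: smooth_pd_mx.
- exact: smooth_mx_mul.
- by apply: smooth_mx_opp => //; exact: smooth_mx_mul.
Qed.

Lemma pd_vjac_sym c d e x : U x ->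
  pd c (fun y => vjac X y d e) x = pd d (fun y => vjac X y c e) x.
Proof.
move=> Ux; transitivity (pd c (pd d (fun y => X y e)) x).
  by apply: pd_eq_on Uo Ux _ => y _; rewrite mxE.
rewrite (smooth_pd_comm _ _ Uo (sX e) Ux).
by apply: pd_eq_on Uo Ux _ => y _; rewrite mxE.
Qed.

(** Differentiates the formula for X(Gamma) along c; the last sum is the commutator of d_c and X. *)
Lemma xder_pd_conn c d x : U x -> xder_mx X (pd_mx c (Gam d)) x =
  - pd_mx c (pd_mx d (vjac X)) x -
  (\sum_e pd c (fun y => vjac X y d e) x *: Gam e x +
   \sum_e vjac X x d e *: pd_mx c (Gam e) x) -
  ((pd_mx c (vjac X) x *m Gam d x + vjac X x *m pd_mx c (Gam d) x) -
   (pd_mx c (Gam d) x *m vjac X x + Gam d x *m pd_mx c (vjac X) x)) -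
  \sum_e vjac X x c e *: pd_mx e (Gam d) x.
Proof.
move=> Ux; have dp := pd_derivation c Uo Ux.
have sB := smooth_vjac Uo sX.
have s1 := smooth_pd_mx Uo d sB.
have s2 : smooth_mx U (fun y => \sum_e vjac X y d e *: Gam e y).
  by apply: smooth_mx_sumZ => // e; exact: sB.
have s3 := smooth_mx_mul Uo sB (sGam d).
have s4 := smooth_mx_mul Uo (sGam d) sB.
have := pd_xder_mx Uo sX c Ux (sGam d).
rewrite {1}/pd_mx (der_mx_eq dp (fun y Uy => xder_conn d Uy)).
have n1 := smooth_mx_opp Uo s1; have n2 := smooth_mx_opp Uo s2.
have n4 := smooth_mx_opp Uo s4.
have n5 := smooth_mx_add Uo s3 n4; have n6 := smooth_mx_opp Uo n5.
rewrite (der_mxD dp) //; last exact: smooth_mx_add.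
rewrite (der_mxD dp) // !(der_mxN dp) // (der_mxD dp) // (der_mxN dp) //.
rewrite !(der_mxM Uo dp) // (der_mx_sumZ Uo dp) //.
by move/eqP; rewrite -subr_eq => /eqP <-.
Qed.

(** The left-hand side is the Lie derivative of R^e_{bcd}: the commutator accounts for the slots b
    and e, the two sums for c and d. Since the curvature is not obtained by [nabla] from a tensor,
    its invariance is read off from X(Gamma). *)
Lemma lie_curv c d x : U x ->
  xder_mx X (curv c d) x +
  (vjac X x *m curv c d x - curv c d x *m vjac X x) +
  \sum_e vjac X x c e *: curv e d x + \sum_e vjac X x d e *: curv c e x = 0.
Proof.
move=> Ux; have dx := xder_derivation X Uo Ux.
have sP a b := smooth_pd_mx Uo a (sGam b).
have sGG a b := smooth_mx_mul Uo (sGam a) (sGam b).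
have nP a b := smooth_mx_opp Uo (sP a b).
have nGG a b := smooth_mx_opp Uo (sGG a b).
have -> : xder_mx X (curv c d) x =
    xder_mx X (pd_mx c (Gam d)) x - xder_mx X (pd_mx d (Gam c)) x +
    ((xder_mx X (Gam d) x *m Gam c x + Gam d x *m xder_mx X (Gam c) x) -
     (xder_mx X (Gam c) x *m Gam d x + Gam c x *m xder_mx X (Gam d) x)).
  rewrite {1}/xder_mx (der_mxD dx); [|exact: smooth_mx_add..].
  by rewrite (der_mxD dx) // (der_mxD dx) // !(der_mxN dx) // !(der_mxM Uo dx).
rewrite !xder_pd_conn // !xder_conn //.
have -> : \sum_e vjac X x c e *: curv e d x =
    \sum_e vjac X x c e *: pd_mx e (Gam d) x -
    \sum_e vjac X x c e *: pd_mx d (Gam e) x +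
    (Gam d x *m (\sum_e vjac X x c e *: Gam e x) -
     (\sum_e vjac X x c e *: Gam e x) *m Gam d x).
  rewrite mulmx_suml mulmx_sumr -!sumrB -big_split /=; apply: eq_bigr => e _.
  by rewrite /curv !scalerDr !scalerN -scalemxAl -scalemxAr.
have -> : \sum_e vjac X x d e *: curv c e x =
    \sum_e vjac X x d e *: pd_mx c (Gam e) x -
    \sum_e vjac X x d e *: pd_mx e (Gam c) x +
    ((\sum_e vjac X x d e *: Gam e x) *m Gam c x -
     Gam c x *m (\sum_e vjac X x d e *: Gam e x)).
  rewrite mulmx_suml mulmx_sumr -!sumrB -big_split /=; apply: eq_bigr => e _.
  by rewrite /curv !scalerDr !scalerN -scalemxAl -scalemxAr.
(* Second derivatives of [vjac] are symmetric, and d_c d_d xi^e is too; these terms therefore cancel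
   on antisymmetrising in c and d. *)
rewrite (pd_mx_comm Uo d c Ux (smooth_vjac Uo sX)).
have -> : \sum_e pd d (fun y => vjac X y c e) x *: Gam e x =
          \sum_e pd c (fun y => vjac X y d e) x *: Gam e x.
  by apply: eq_bigr => e _; rewrite pd_vjac_sym.
exact: curvature_invariance_identity.
Qed.

(** The entry (a, b) of [K c d] is R_{abcd}. With the upper index lowered, both matrix slots are
    covariant, hence the terms B K and K B^T. *)
Lemma lie_lowered_curv c d x : U x ->
  let K a b y := G y *m (curv a b y)^T in
  xder_mx X (K c d) x + vjac X x *m K c d x + K c d x *m (vjac X x)^T +
  \sum_e vjac X x c e *: K e d x + \sum_e vjac X x d e *: K c e x = 0.
Proof.
move=> Ux K; have dx := xder_derivation X Uo Ux.
have sR := smooth_curv c d; have sRT := smooth_mx_tr Uo sR.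
have -> : xder_mx X (K c d) x =
    xder_mx X G x *m (curv c d x)^T + G x *m (xder_mx X (curv c d) x)^T.
  by rewrite {1}/xder_mx (der_mxM Uo dx) // (der_mxT dx).
have sK (w : 'I_D -> R) (C : 'I_D -> 'M[R]_D) :
    \sum_e w e *: (G x *m (C e)^T) = G x *m (\sum_e w e *: C e)^T.
  rewrite linear_sum mulmx_sumr; apply: eq_bigr => e _.
  by rewrite linearZ /= -scalemxAr.
rewrite /K !sK G_killing //.
by apply: etrans (lowering_identity _ _ _ _ _ _) _; rewrite lie_curv // trmx0 mulmx0.
Qed.

Lemma lie_riemann_components x (I : 4.-tuple 'I_D) : U x ->
  let K a b y := G y *m (curv a b y)^T in
  let T y (J : 4.-tuple 'I_D) := K (tnth J (inord 2)) (tnth J (inord 3)) y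
    (tnth J (inord 0)) (tnth J (inord 1)) in
  xder X (fun y => T y I) x + act (vjac X x) (T x) I = 0.
Proof.
move=> Ux K T; have := lie_lowered_curv (tnth I (inord 2)) (tnth I (inord 3)) Ux.
move=> /= /matrixP/(_ (tnth I (inord 0)) (tnth I (inord 1))).
rewrite zero_mxE => E; apply: etrans E.
rewrite !add_mxE !summxE xder_mxE -!addrA; congr (_ + _).
have [e0 e1 e2 e3] : [/\ (inord 0 : 'I_4) = ord0, (inord 1 : 'I_4) = lift ord0 ord0,
   (inord 2 : 'I_4) = lift ord0 (lift ord0 ord0) &
   (inord 3 : 'I_4) = lift ord0 (lift ord0 (lift ord0 ord0))].
  by split; apply: val_inj; rewrite /= inordK.
rewrite /act !big_ord_recl big_ord0 addr0 /T e0 e1 e2 e3.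
congr (_ + (_ + (_ + _))).
- by rewrite mxE; apply: eq_bigr => a _; rewrite !tnth_subst.
- rewrite mxE; apply: eq_bigr => a _; rewrite !tnth_subst.
  by rewrite [(vjac X x)^T _ _]mxE mulrC.
- by apply: eq_bigr => a _; rewrite !tnth_subst [RHS]mxE.
- by apply: eq_bigr => a _; rewrite !tnth_subst [RHS]mxE.
Qed.

Lemma sum_mul_trace (P Q : 'M[R]_D) :
  \sum_a \sum_b P a b * Q a b = \tr (P^T *m Q).
Proof.
rewrite exchange_big /mxtrace; apply: eq_bigr => b _ /=; rewrite mxE.
by apply: eq_bigr => a _; rewrite mxE.
Qed.

(** Contraction commutes with the Lie derivative because the inverse metric is invariant. No
    invariance of [T] is assumed, since the lemma also serves for the product of dphi with
    itself. *)
Lemma lie_contraction k (T : 'rV[R]_D -> k.+2.-tuple 'I_D -> R) x (I : k.-tuple 'I_D) : U x ->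
  (forall J, smooth_on U (fun y => T y J)) ->
  xder X (fun y => \sum_a \sum_b invmx (G y) a b * T y [tuple of a :: b :: I]) x +
  act (vjac X x) (fun J => \sum_a \sum_b invmx (G x) a b * T x [tuple of a :: b :: J]) I
  = \sum_a \sum_b invmx (G x) a b *
      (xder X (fun y => T y [tuple of a :: b :: I]) x +
       act (vjac X x) (T x) [tuple of a :: b :: I]).
Proof.
move=> Ux sT; have dx := xder_derivation X Uo Ux.
have sH := smooth_invmx Uo sG G_unit.
set H := invmx (G x); set B := vjac X x.
have XH : xder_mx X (fun y => invmx (G y)) x = H *m B + B^T *m H.
  rewrite /xder_mx (der_invmx Uo Ux dx) // -/(xder_mx X G x) G_killing // -/H -/B.
  rewrite mulmxBr mulmxBl opprB mulmxN mulNmx opprK addrC.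
  have Gu := G_unit Ux; congr (_ + _).
    by rewrite -!mulmxA mulmxV // mulmx1.
  by rewrite !mulmxA mulVmx // mul1mx.
pose L J := xder X (fun y => T y J) x + act B (T x) J.
pose t := \matrix_(a, b) T x [tuple of a :: b :: I].
have -> : xder X (fun y => \sum_a \sum_b invmx (G y) a b * T y [tuple of a :: b :: I]) x =
    \sum_a \sum_b (H *m B + B^T *m H) a b * t a b +
    \sum_a \sum_b H a b * (L [tuple of a :: b :: I] - (B *m t) a b - (t *m B^T) a b -
      act B (fun J => T x [tuple of a :: b :: J]) I).
  rewrite (der_sum Uo dx); last first.
    by move=> a _; apply: smooth_sum => // b _; apply: smoothM => //; exact: sH.
  rewrite -big_split /=; apply: eq_bigr => a _; rewrite (der_sum Uo dx); last first.
    by move=> b _; apply: smoothM => //; exact: sH.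
  rewrite -big_split /=; apply: eq_bigr => b _.
  rewrite (derM dx) //.
  rewrite -[xder X (fun y => invmx (G y) a b) x]xder_mxE XH [t a b]mxE -/H.
  congr (_ + _ * _); rewrite /L.
  have -> : [tuple of a :: b :: I] = [tuple of a :: [tuple of b :: I]] by apply: val_inj.
  have -> : act B (T x) [tuple of a :: [tuple of b :: I]] =
      (B *m t) a b + ((t *m B^T) a b + act B (fun J => T x [tuple of a :: b :: J]) I).
    rewrite !act_cons; congr (_ + (_ + _)).
      by rewrite mxE; apply: eq_bigr => e _; rewrite [t e b]mxE; congr (_ * T x _).
    rewrite mxE; apply: eq_bigr => e _; rewrite [t a e]mxE [B^T e b]mxE mulrC.
    by congr (T x _ * _).
  move: ((B *m t) a b) ((t *m B^T) a b) (act B _ I) (xder _ _ _) => p q r z.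
  by ring.
rewrite act_sumt -addrA -big_split /=.
rewrite [X in _ + X](_ : _ = \sum_a \sum_b H a b * L [tuple of a :: b :: I] -
    \sum_a \sum_b H a b * (B *m t + t *m B^T) a b); last first.
  rewrite -sumrB; apply: eq_bigr => a _.
  rewrite act_sumt -big_split -sumrB; apply: eq_bigr => b _ /=.
  by rewrite actZt -mulrDr subrK -mulrBr add_mxE opprD addrA.
(* As traces, the derivative of the inverse metric and the action on the two contracted slots cancel
   by cyclicity. *)
rewrite !sum_mul_trace addrCA [X in _ + X](_ : _ = 0) ?addr0 //.
rewrite trmx_add !trmx_mul trmxK mulmxDl mulmxDr !mxtraceD -!mulmxA.
by rewrite [\tr (B^T *m _)]mxtrace_mulC -!mulmxA [X in X - _]addrC subrr.
Qed.

(** Transposing two slots with equal indices fixes [I] but has sign -1. *)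
Lemma subst_antisym k (T : k.-tuple 'I_D -> R) (I : k.-tuple 'I_D) r s :
  (forall (p : 'S_k) J, T (permute_index p J) = (-1) ^+ p * T J) ->
  r != s -> tnth I r = tnth I s -> T I = 0.
Proof.
move=> anti rs E; have := anti (tperm r s) I.
have -> : permute_index (tperm r s) I = I.
  apply: eq_from_tnth => q; rewrite tnth_mktuple.
  by case: tpermP => [->|->|].
by rewrite odd_tperm rs expr1 mulN1r; lra.
Qed.

(** The Lie derivative of [eps] is again totally antisymmetric, so one component decides. There the
    action of [vjac] is multiplication by its trace, which balances the derivative of the square
    root of |det g| given by Jacobi's formula and the Killing equation. *)
Lemma lie_levi_civita (eps : 'rV[R]_D -> D.-tuple 'I_D -> R) x :
  U x -> (forall I, smooth_on U (fun y => eps y I)) ->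
  (forall y, U y -> forall (s : 'S_D) I,
     eps y (permute_index s I) = (-1) ^+ s * eps y I) ->
  (forall y, U y -> `|eps y [tuple i | i < D]| = Num.sqrt `|\det (G y)|) ->
  forall I, xder X (fun y => eps y I) x + act (vjac X x) (eps x) I = 0.
Proof.
move=> Ux se anti norm; have dx := xder_derivation X Uo Ux.
pose Id := [tuple i | i < D].
pose L I := xder X (fun y => eps y I) x + act (vjac X x) (eps x) I.
have Lanti (s : 'S_D) J : L (permute_index s J) = (-1) ^+ s * L J.
  rewrite /L mulrDr; congr (_ + _).
    rewrite -(derZ dx) //; apply: (der_eq dx) => y Uy; exact: anti.
  by rewrite -act_permute -actZt; apply: eq_act => K; exact: anti.
have detN0 y : U y -> \det (G y) != 0.
  by move=> Uy; rewrite -unitfE -unitmxE G_unit.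
have epsX : eps x Id != 0.
  by rewrite -normr_eq0 norm // sqrtr_eq0 -ltNge normr_gt0 detN0.
(* Replacing the index s by another a duplicates a, so only the diagonal of [vjac] survives. *)
have act_Id : act (vjac X x) (eps x) Id = \tr (vjac X x) * eps x Id.
  rewrite /act /mxtrace mulr_suml; apply: eq_bigr => s _.
  rewrite (bigD1 s) //= big1 => [|a as_]; last first.
    rewrite (@subst_antisym _ _ _ a s) ?mulr0 //; first exact: anti.
    by rewrite !tnth_subst eqxx (negbTE as_) tnth_mktuple.
  rewrite addr0 tnth_mktuple; congr (_ * eps x _).
  apply: eq_from_tnth => r; rewrite tnth_subst tnth_mktuple.
  by case: eqP => // ->.
have xdet : xder X (fun y => \det (G y)) x =
    - ((\tr (vjac X x) * \det (G x)) *+ 2).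
  rewrite (der_det Uo dx) // -/(xder_mx X G x) G_killing // mulmxBl mulNmx.
  rewrite raddfB raddfN /= -!mulmxA mul_mx_adj mul_mx_scalar linearZ /=.
  rewrite [\tr (G x *m _)]mxtrace_mulC -mulmxA mul_adj_mx mul_mx_scalar.
  rewrite [in X in _ - X]mxtraceZ mxtrace_tr.
  by rewrite -opprD -mulr2n mulrC.
(* eps^4 = (det g)^2 is differentiated, so that the sign of det g plays no role. *)
have L_Id : L Id = 0.
  rewrite /L act_Id.
  have E4 y : U y -> (eps y Id * eps y Id) * (eps y Id * eps y Id) =
      \det (G y) * \det (G y).
    move=> Uy; have E : eps y Id * eps y Id = `|\det (G y)|.
      rewrite -[LHS]ger0_norm; last by rewrite -expr2 sqr_ge0.
      by rewrite normrM norm // -expr2 sqr_sqrtr.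
    by rewrite E -normrM ger0_norm // -expr2 sqr_ge0.
  have sE := se Id; have sE2 := smoothM Uo sE sE.
  have sdet := smooth_det Uo sG.
  have := der_eq dx E4; rewrite (derM dx) // !(derM dx) // xdet.
  move: (E4 x Ux) epsX; move: (eps x Id) (\det (G x)) (xder X _ x) (\tr _).
  move=> e D' e' t E e0 H.
  (* The factor 4 e^3 comes from differentiating e^4, and it can be cancelled. *)
  have e3 : e * e * e * 4 != 0.
    by rewrite !mulf_neq0 // pnatr_eq0.
  apply: (mulfI e3); rewrite mulr0.
  have -> : e * e * e * 4 * (e' + t * e) =
    ((e' * e + e * e') * (e * e) + e * e * (e' * e + e * e')) + t * 4 * (e * e * (e * e)).
    by ring.
  by rewrite H E; ring.
move=> I; rewrite -/(L I).
have [/injectiveP inj|ninj] := boolP (injectiveb (tnth I)).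
  have -> : I = permute_index (perm inj) Id.
    by apply: eq_from_tnth => r; rewrite !tnth_mktuple permE.
  by rewrite Lanti L_Id mulr0.
have /injectivePn[r [s rs E]] := ninj.
exact: subst_antisym Lanti rs E.
Qed.

End InvariantTensors.

(** * Invariance of curvature polynomials *)

Lemma tupleE2 (T : Type) (I : 2.-tuple T) :
  I = [tuple tnth I ord0; tnth I ord_max].
Proof.
apply: eq_from_tnth => r; case: (unliftP ord0 r) => [j|] -> //.
by rewrite (ord1 j); congr tnth; apply: val_inj.
Qed.

Lemma metric_mxE (R : realType) D (M : topologicalType) (g : @tensor_field R D M 2)
  c y a b : metric_mx g c y a b = g c y [tuple a; b].
Proof. by rewrite mxE. Qed.

Definition conn_mx (R : realType) D (M : topologicalType) (g : @tensor_field R D M 2)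
  c a (y : 'rV[R]_D) : 'M[R]_D := \matrix_(i, e) christoffel g c y e a i.

Lemma conn_mxE (R : realType) D (M : topologicalType) (g : @tensor_field R D M 2)
  c y a i e : conn_mx g c a y i e = christoffel g c y e a i.
Proof. by rewrite mxE. Qed.

Local Opaque metric_mx conn_mx.

Section Invariance.
Context {R : realType} (D : nat) (M : topologicalType).
Variables (A : set (@chart R D M)) (g : @tensor_field R D M 2).
Variable xi : @vector_field R D M.

(** Puts the component definition into the form of a derivation plus a matrix action, in which all
    invariance statements are proved. *)
Lemma lieE k (T : @tensor_field R D M k) c x I :
  lie xi T c x I =
  xder (xi c) (fun y => T c y I) x + act (vjac (xi c) x) (T c x) I.
Proof.
rewrite /lie /xder /act; congr (_ + _); apply: eq_bigr => s _.
by apply: eq_bigr => a _; rewrite mxE.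
Qed.

Hypotheses (hA : is_atlas A) (hg : is_lorentzian_metric A g).
Hypothesis hxi : killing A g xi.

Lemma cimg_open c : A c -> open (cimg c).
Proof. by have [hc _ _] := hA; move=> /hc[]. Qed.

Section Chart.
Variable c : @chart R D M.
Hypothesis Ac : A c.
Let U := cimg c.
Let X := xi c.
Let G := metric_mx g c.

Let Gam := conn_mx g c.

Let Uo : open U. Proof. exact: cimg_open. Qed.

Lemma smooth_xi a : smooth_on U (fun y => X y a).
Proof. by have [[sxi _] _] := hxi; exact: sxi. Qed.

Lemma smooth_g I : smooth_on U (fun y => g c y I).
Proof. by have [[sg _] _ _] := hg; exact: sg. Qed.

Lemma smooth_metric_mx : smooth_mx U G.
Proof.
move=> a b; apply: (smooth_eq Uo _ (smooth_g [tuple a; b])) => y _.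
by rewrite metric_mxE.
Qed.

Lemma metric_mx_sym y : U y -> (G y)^T = G y.
Proof. by have [_ sym _] := hg => Uy; exact: sym. Qed.

Lemma metric_sym y a b : U y -> g c y [tuple a; b] = g c y [tuple b; a].
Proof. by move=> /metric_mx_sym/matrixP/(_ b a); rewrite [_^T _ _]mxE !metric_mxE. Qed.

(** The metric is congruent to the Minkowski matrix, whose determinant is a product of signs. *)
Lemma metric_unit y : U y -> G y \in unitmx.
Proof.
move=> Uy; have [_ _ /(_ c y Ac Uy)[P Pu E]] := hg.
have : (Defs.minkowski D : 'M[R]_D) \in unitmx.
  rewrite unitmxE /Defs.minkowski det_diag unitfE prodf_seq_neq0; apply/allP => i _ /=.
  by rewrite mxE; case: ifP => _; rewrite ?oppr_eq0 oner_eq0.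
by rewrite -E !unitmx_mul => /andP[/andP[_]].
Qed.

Lemma smooth_inverse_metric a b : smooth_on U (fun y => inverse_metric g c y a b).
Proof. exact: (smooth_invmx Uo smooth_metric_mx metric_unit). Qed.

Lemma smooth_christoffel e a i : smooth_on U (fun y => christoffel g c y e a i).
Proof.
apply: smoothM => //; first exact: smooth_cst.
apply: smooth_sum => // m _; apply: smoothM => //.
  exact: smooth_inverse_metric.
apply: smoothB => //; first apply: smoothD => //.
all: by apply: smooth_pd; exact: smooth_g.
Qed.

Lemma smooth_conn_mx a : smooth_mx U (Gam a).
Proof.
move=> i e; apply: (smooth_eq Uo _ (smooth_christoffel e a i)) => y _.
by rewrite conn_mxE.
Qed.

Lemma conn_torsion_free y : U y -> forall a b e, Gam a y b e = Gam b y a e.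
Proof.
move=> Uy a b e; rewrite !conn_mxE /christoffel; congr (_ * _); apply: eq_bigr => m _.
congr (_ * (_ - _)).
  rewrite addrC; congr (_ + _); apply: (pd_eq_on _ Uo Uy) => z Uz.
    exact: metric_sym.
  exact: metric_sym.
by apply: (pd_eq_on _ Uo Uy) => z Uz; exact: metric_sym.
Qed.

Lemma conn_metricity y : U y -> forall a,
  pd_mx a G y = Gam a y *m G y + G y *m (Gam a y)^T.
Proof.
move=> Uy a.
(* Twice the Christoffel symbol of the first kind. Its last two terms are antisymmetric in i and m,
   so S + S^T is twice d_a g. *)
pose S := \matrix_(i, m) (pd a (fun z => g c z [tuple m; i]) y +
  pd i (fun z => g c z [tuple a; m]) y - pd m (fun z => g c z [tuple a; i]) y).
have GamE : Gam a y *m G y = 2^-1 *: S.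
  have -> : Gam a y = 2^-1 *: (S *m invmx (G y)).
    apply/matrixP => i e; rewrite conn_mxE /christoffel 2!mxE; congr (_ * _).
    apply: eq_bigr => m _; rewrite [S i m]mxE mulrC; congr (_ * _).
    rewrite /inverse_metric -/G -[in RHS](metric_mx_sym Uy).
    by rewrite -trmx_inv [in RHS]mxE.
  by rewrite -scalemxAl mulmxKV // metric_unit.
have -> : G y *m (Gam a y)^T = (Gam a y *m G y)^T.
  by rewrite trmx_mul metric_mx_sym.
rewrite GamE; apply/matrixP => i j; rewrite pd_mxE !mxE.
have E (k m n : 'I_D) : pd k (fun z => g c z [tuple m; n]) y =
    pd k (fun z => g c z [tuple n; m]) y.
  by apply: (pd_eq_on _ Uo Uy) => z Uz; exact: metric_sym.
have -> : pd a (fun z => G z i j) y = pd a (fun z => g c z [tuple i; j]) y.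
  by apply: (pd_eq_on _ Uo Uy) => z Uz; rewrite metric_mxE.
by rewrite (E a j i); field.
Qed.

Lemma lie_metric y I : U y -> lie xi g c y I = 0.
Proof.
move=> [p cp <-]; have [_ /(_ p)] := hxi.
by move=> /(_ c Ac cp I).
Qed.

Lemma metric_killing y : U y ->
  xder_mx X G y = - (vjac X y *m G y) - G y *m (vjac X y)^T.
Proof.
move=> Uy; have dx := xder_derivation X Uo Uy.
apply/matrixP => a b; rewrite xder_mxE add_mxE !opp_mxE.
have := lie_metric [tuple a; b] Uy; rewrite lieE.
have -> : [tuple a; b] = [tuple of a :: [tuple of b :: [tuple]]] by apply: val_inj.
rewrite !act_cons act_tuple0 addr0.
have -> : xder (xi c) (fun z => g c z [tuple of a :: [tuple of b :: [tuple]]]) y =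
    xder X (fun z => G z a b) y.
  apply: (der_eq dx) => z Uz; rewrite metric_mxE; congr (g c z _); exact: val_inj.
move=> /eqP; rewrite addr_eq0 => /eqP ->; rewrite opprD mxE; congr (- _ - _).
  apply: eq_bigr => e _; rewrite [G y e b]metric_mxE; congr (_ * g c y _).
rewrite mxE; apply: eq_bigr => e _; rewrite [G y a e]metric_mxE [_^T e b]mxE mulrC.
by congr (g c y _ * _).
Qed.

Let xconn a x : U x -> xder_mx X (Gam a) x =
  - pd_mx a (vjac X) x - \sum_e vjac X x a e *: Gam e x -
  (vjac X x *m Gam a x - Gam a x *m vjac X x).
Proof.
move=> Ux; exact: (xder_conn Uo smooth_xi smooth_metric_mx smooth_conn_mx
  metric_mx_sym metric_unit conn_torsion_free conn_metricity metric_killing).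
Qed.

Lemma riemannE y (I : 4.-tuple 'I_D) : riemann g c y I =
  (G y *m (curv Gam (tnth I (inord 2)) (tnth I (inord 3)) y)^T)
    (tnth I (inord 0)) (tnth I (inord 1)).
Proof.
rewrite /riemann mxE; apply: eq_bigr => e _.
rewrite [G y _ _]metric_mxE [_^T _ _]mxE curvE; congr (_ * (_ - _ + _)).
- by congr (pd _ _ _); apply/funext => z; rewrite conn_mxE.
- by congr (pd _ _ _); apply/funext => z; rewrite conn_mxE.
apply: eq_bigr => f _; rewrite !conn_mxE; congr (_ - _); exact: mulrC.
Qed.

Local Opaque curv riemann.

Lemma smooth_riemann I : smooth_on U (fun y => riemann g c y I).
Proof.
have sK := smooth_mx_mul Uo smooth_metric_mx (smooth_mx_tr Uo
  (smooth_curv Uo smooth_conn_mx (tnth I (inord 2)) (tnth I (inord 3)))).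
by apply: (smooth_eq Uo _ (sK (tnth I (inord 0)) (tnth I (inord 1)))) => y _; rewrite riemannE.
Qed.

Lemma lie_riemann y I : U y -> lie xi (riemann g) c y I = 0.
Proof.
move=> Uy; have dx := xder_derivation X Uo Uy.
have := lie_riemann_components Uo smooth_xi smooth_metric_mx smooth_conn_mx
  metric_killing xconn I Uy.
move=> E; rewrite lieE; apply: etrans E; congr (_ + _).
  by apply: (der_eq dx) => z Uz; exact: riemannE.
by apply: eq_act => J; exact: riemannE.
Qed.

Lemma nablaE k (T : @tensor_field R D M k) y a (J : k.-tuple 'I_D) :
  nabla g T c y [tuple of a :: J] =
  pd a (fun z => T c z J) y - act (Gam a y) (T c y) J.
Proof.
rewrite /nabla theadE.
have -> : [tuple of behead [tuple of a :: J]] = J by apply: val_inj.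
congr (_ - _); apply: eq_bigr => s _; apply: eq_bigr => e _.
by rewrite conn_mxE.
Qed.

Lemma lie_nabla k (T : @tensor_field R D M k) :
  (forall J, smooth_on U (fun y => T c y J)) ->
  (forall y J, U y -> lie xi T c y J = 0) ->
  forall y I, U y -> lie xi (nabla g T) c y I = 0.
Proof.
(* The derivative index is one more slot for the action; [act_cons] separates it as the sum over
   e. *)
move=> sT LT y I Uy; case/tupleP: I => a J.
rewrite lieE act_cons addrA.
apply: (lie_covariant_derivative Uo smooth_xi smooth_metric_mx smooth_conn_mx
  metric_mx_sym metric_unit conn_torsion_free conn_metricity metric_killing
  (T := T c) (N := fun a J y => nabla g T c y [tuple of a :: J])) => //.
- by move=> b K z; exact: nablaE.
- by move=> z K Uz; rewrite -lieE LT.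
Qed.

Lemma lie_contract k (T : @tensor_field R D M k.+2) :
  (forall J, smooth_on U (fun y => T c y J)) ->
  (forall y J, U y -> lie xi T c y J = 0) ->
  forall y I, U y -> lie xi (Defs.contract g T) c y I = 0.
Proof.
move=> sT LT y I Uy; rewrite lieE.
apply: etrans (lie_contraction Uo smooth_metric_mx metric_unit metric_killing
  (T := T c) I Uy sT) _.
by apply: big1 => a _; apply: big1 => b _; rewrite -lieE LT ?mulr0.
Qed.

(** Smoothness is carried through the induction because the rules for products, contractions and
    [nabla] require it. *)
Lemma curvature_eval_invariant (eps : @tensor_field R D M D) k
    (E : @curvature_poly R D k) :
  (mentions_levi_civita E -> is_levi_civita A g eps) ->
  (forall I, smooth_on U (fun y => curvature_eval g eps E c y I)) /\
  (forall y I, U y -> lie xi (curvature_eval g eps E) c y I = 0).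
Proof.
elim: E => {k} [a||||k E1 IH1 E2 IH2|m n E1 IH1 E2 IH2|k s E1 IH1|k E1 IH1|k E1 IH1] /= hE.
- split=> [I|y I Uy]; first exact: smooth_cst.
  by rewrite lieE act_tuple0 addr0; exact: der_cst (xder_derivation X Uo Uy) _.
- by split=> [I|y I Uy]; [exact: smooth_g|exact: lie_metric].
- by split=> [I|y I Uy]; [exact: smooth_riemann|exact: lie_riemann].
- have [[seps _] anti norm] := hE isT.
  split=> [I|y I Uy]; first exact: seps.
  rewrite lieE; apply: (lie_levi_civita Uo smooth_metric_mx metric_unit
    metric_killing Uy (eps := eps c)) => [J|z Uz|z Uz]; first exact: seps.
    exact: anti.
  exact: norm.
- have [s1 L1] := IH1 (fun h => hE (introT orP (or_introl h))).
  have [s2 L2] := IH2 (fun h => hE (introT orP (or_intror h))).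
  split=> [I|y I Uy]; first exact: smoothD.
  rewrite lieE (derD (xder_derivation X Uo Uy)) // actDt addrACA -!lieE.
  by rewrite L1 // L2 // addr0.
- have [s1 L1] := IH1 (fun h => hE (introT orP (or_introl h))).
  have [s2 L2] := IH2 (fun h => hE (introT orP (or_intror h))).
  split=> [I|y I Uy]; first exact: smoothM.
  rewrite lieE (derM (xder_derivation X Uo Uy)) // act_mul.
  move: (L1 y [tuple tnth I (lshift n r) | r < m] Uy); rewrite lieE => /eqP.
  rewrite addr_eq0 => /eqP ->.
  move: (L2 y [tuple tnth I (rshift m r) | r < n] Uy); rewrite lieE => /eqP.
  rewrite addr_eq0 => /eqP ->.
  by rewrite mulNr mulrN addrACA !addNr addr0.
- have [s1 L1] := IH1 hE; split=> [I|y I Uy]; first exact: s1.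
  by rewrite lieE act_permute -lieE L1.
- have [s1 L1] := IH1 hE; split=> [I|y I Uy]; last exact: lie_contract.
  apply: smooth_sum => // a _; apply: smooth_sum => // b _; apply: smoothM => //.
  exact: smooth_inverse_metric.
- have [s1 L1] := IH1 hE; split=> [I|y I Uy]; last exact: lie_nabla.
  apply: smoothB => //; first exact: smooth_pd.
  apply: smooth_sum => // s _; apply: smooth_sum => // d _; apply: smoothM => //.
  exact: smooth_christoffel.
Qed.

End Chart.
End Invariance.

Local Opaque curv riemann.

(** * The scalar field *)

Section CovectorAlgebra.
Context {R : realFieldType} {n : nat}.
Implicit Types (u w : 'rV[R]_n) (G : 'M[R]_n).

(** The pairing g^{ab} u_a w_b of two covectors. *)
Definition dual_form G u w : R := (u *m invmx G *m w^T) 0 0.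

Lemma dual_form_tr G u w : G^T = G -> dual_form G u w = dual_form G w u.
Proof.
move=> Gs; rewrite /dual_form -[RHS](_ : ((w *m invmx G *m u^T)^T) 0 0 = _).
  by rewrite !trmx_mul trmxK trmx_inv Gs mulmxA.
by rewrite mxE.
Qed.

(** The tensor equation is contracted on one index with a covector z through the inverse metric; z =
    u and z = w give the two relations. *)
Lemma symmetric_product_contract G u w k : G^T = G -> G \in unitmx ->
  u^T *m w + w^T *m u = k *: G ->
  dual_form G u u *: w = (k - dual_form G u w) *: u /\
  dual_form G w w *: u = (k - dual_form G u w) *: w.
Proof.
move=> Gs Gu E.
have C z : dual_form G z u *: w + dual_form G z w *: u = k *: z.
  have := congr1 (mulmx (z *m invmx G)) E.
  have Q p q : z *m invmx G *m (p^T *m q) = dual_form G z p *: q.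
    by rewrite mulmxA [X in X *m q]mx11_scalar mul_scalar_mx.
  by rewrite mulmxDr !Q -scalemxAr mulmxKV.
split.
  by rewrite scalerBl -C addrK.
by rewrite scalerBl -C (dual_form_tr w u) // [X in X - _]addrC addrK.
Qed.

(** Here k - g(u, w) is exactly [v], so a nonzero [v] makes u a multiple of w. In dimension one v =
    g(u, w) solves the equation, which is why the rank has to enter. *)
Lemma symmetric_product_trace_part G u w v : (1 < n)%N ->
  G^T = G -> G \in unitmx ->
  u^T *m w + w^T *m u = (dual_form G u w + v) *: G -> v = 0.
Proof.
move=> n1 Gs Gu E; have [] := symmetric_product_contract Gs Gu E.
rewrite addrAC subrr add0r => Eu Ew; apply/eqP; apply: contraT => v0.
set p := dual_form G u u in Eu.
have uE : u = (p / v) *: w.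
  by rewrite mulrC -scalerA Eu scalerA mulVf // scale1r.
have E' : (dual_form G u w + v) *: G = (2 * (p / v)) *: (w^T *m w).
  rewrite -E uE linearZ /= -scalemxAl -scalemxAr -scalerDl; congr (_ *: _); ring.
(* A nonzero multiple of G has rank n > 1, whereas w^T w has rank at most one. *)
have k0 : dual_form G u w + v = 0.
  apply/eqP; apply: contraT => k0.
  have : (\rank ((dual_form G u w + v) *: G) <= 1)%N.
    rewrite E'; apply: leq_trans (mxrank_scale _ _) _.
    by apply: leq_trans (mxrankM_maxl _ _) _; exact: rank_leq_col.
  by rewrite mxrank_scale_nz // mxrank_unit // leqNgt n1.
(* With the right-hand side zero, either the factor p/v or w vanishes, and u = (p/v) w vanishes in
   both cases; then g(u, w) + v = 0 reads v = 0. *)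
have u0 : u = 0.
  move: E'; rewrite k0 scale0r => /esym/eqP; rewrite scaler_eq0 mulf_eq0 pnatr_eq0 /=.
  case/orP => [/eqP p0|]; first by rewrite uE p0 scale0r.
  move=> /eqP ww; rewrite uE (_ : w = 0) ?scaler0 //.
  apply/rowP => i; move/matrixP/(_ i i): ww.
  rewrite !mxE big_ord1 !mxE => /eqP; rewrite mulf_eq0 orbb => /eqP ->.
  by [].
move: k0; rewrite u0 /dual_form !mul0mx mxE add0r => vv.
by rewrite vv eqxx in v0.
Qed.

(** Where w_b is nonzero, the entry (b, b) gives u_b = 0, and the entries (a, b) then give the other
    components. *)
Lemma symmetric_product_eq0 u w : u^T *m w + w^T *m u = 0 -> w != 0 -> u = 0.
Proof.
move=> E; have {}E a b : u 0 a * w 0 b + w 0 a * u 0 b = 0.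
  by move/matrixP/(_ a b): E; rewrite !mxE !big_ord1 !mxE.
case/rV0Pn => b wb; have ub : u 0 b = 0.
  have := E b b; rewrite [w 0 b * _]mulrC -mulr2n => /eqP.
  by rewrite mulrn_eq0 /= mulf_eq0 (negbTE wb) orbF => /eqP.
apply/rowP => a; rewrite mxE; have := E a b.
by rewrite ub mulr0 addr0 => /eqP; rewrite mulf_eq0 (negbTE wb) orbF => /eqP.
Qed.

End CovectorAlgebra.

(** * The Lie derivative of the stress-energy tensor and the gradient equation *)

Section ScalarField.
Context {R : realType} (D : nat) (M : topologicalType).
Variables (A : set (@chart R D M)) (g : @tensor_field R D M 2).
Variable xi : @vector_field R D M.
Hypotheses (hA : is_atlas A) (hg : is_lorentzian_metric A g).
Hypothesis hxi : killing A g xi.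
Variables (phi : M -> R) (V : R -> R).
Hypotheses (hphi : smooth_function A phi) (hV : forall s, derivable V s 1).
Variable c : @chart R D M.
Hypothesis Ac : A c.
Let U := cimg c.
Let X := xi c.
Let G := metric_mx g c.
Let phic y := phi (cinv c y).
Let f := xder X phic.

Let Uo : open U. Proof. exact: cimg_open Ac. Qed.
Let sX a : smooth_on U (fun y => X y a). Proof. by apply: (smooth_xi hxi).
 Qed.
Let sphi : smooth_on U phic. Proof. exact: hphi. Qed.
Let sf : smooth_on U f. Proof. exact: smooth_xder. Qed.

Definition dscalar (h : 'rV[R]_D -> R) y : 'rV[R]_D := \row_a pd a h y.

Lemma lie_scalar y I : lie xi (scalar_field phi) c y I = f y.
Proof. by rewrite lieE act_tuple0 addr0. Qed.

Lemma differential_lie y I :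
  differential (lie xi (scalar_field phi)) c y I = pd (thead I) f y.
Proof.
by rewrite /differential; congr (pd _ _ y); apply/funext => z; exact: lie_scalar.
Qed.

Lemma stress_energyE y I : stress_energy g V phi c y I =
  pd (tnth I ord0) phic y * pd (tnth I ord_max) phic y -
  (2^-1 * (\sum_a \sum_b inverse_metric g c y a b * (pd a phic y * pd b phic y)) +
   V (phic y)) * g c y I.
Proof.
rewrite /stress_energy.
have E a : nabla g (scalar_field phi) c y [tuple a] = pd a phic y.
  have -> : [tuple a] = [tuple of a :: [tuple]] by apply: val_inj.
  by rewrite nablaE act_tuple0 subr0.
rewrite !E; congr (_ - (_ * _ + _) * _).
apply: eq_bigr => a _; apply: eq_bigr => b _.
by rewrite !E mulrA.
Qed.

(** The Lie derivative commutes with the exterior derivative: L_xi dphi = d(xi(phi)). *)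
Lemma xder_pd_scalar a y : U y ->
  xder X (pd a phic) y + \sum_e vjac X y a e * pd e phic y = pd a f y.
Proof.
move=> Uy; rewrite (pd_xder a Uo Uy sX sphi); congr (_ + _).
by apply: eq_bigr => e _; rewrite mxE.
Qed.

Let grad2 y (J : 2.-tuple 'I_D) := pd (tnth J ord0) phic y * pd (tnth J ord_max) phic y.

Let sgrad2 J : smooth_on U (fun y => grad2 y J).
Proof. by apply: smoothM => //; exact: smooth_pd. Qed.

Lemma lie_grad2 y J : U y ->
  xder X (fun z => grad2 z J) y + act (vjac X y) (grad2 y) J =
  pd (tnth J ord0) f y * pd (tnth J ord_max) phic y +
  pd (tnth J ord0) phic y * pd (tnth J ord_max) f y.
Proof.
move=> Uy; have dx := xder_derivation X Uo Uy.
rewrite (derM dx); [|exact: smooth_pd..].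
set a := tnth J ord0; set b := tnth J ord_max.
have -> : act (vjac X y) (grad2 y) J =
    (\sum_e vjac X y a e * pd e phic y) * pd b phic y +
    pd a phic y * (\sum_e vjac X y b e * pd e phic y).
  rewrite [J in LHS]tupleE2 -/a -/b.
  have -> : [tuple a; b] = [tuple of a :: [tuple of b :: [tuple]]] by apply: val_inj.
  rewrite !act_cons act_tuple0 addr0 mulr_suml mulr_sumr; congr (_ + _).
    by apply: eq_bigr => e _; rewrite mulrA.
  by apply: eq_bigr => e _; rewrite mulrCA.
by rewrite -(xder_pd_scalar a Uy) -(xder_pd_scalar b Uy) mulrDl mulrDr addrACA.
Qed.

Lemma inverse_metric_form y p q :
  \sum_a \sum_b inverse_metric g c y a b * (p a * q b) =
  dual_form (G y) (\row_a p a) (\row_a q a).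
Proof.
rewrite /dual_form mxE exchange_big; apply: eq_bigr => b _ /=.
rewrite !mxE mulr_suml; apply: eq_bigr => a _.
by rewrite mxE mulrA; congr (_ * _); exact: mulrC.
Qed.

Let kin y := \sum_a \sum_b inverse_metric g c y a b * (pd a phic y * pd b phic y).

Lemma smooth_kinetic : smooth_on U kin.
Proof.
apply: smooth_sum => // a _; apply: smooth_sum => // b _; apply: smoothM => //.
  exact: (smooth_inverse_metric hA hg Ac).
by apply: smoothM => //; exact: smooth_pd.
Qed.

Lemma kineticE y : kin y = dual_form (G y) (dscalar phic y) (dscalar phic y).
Proof. exact: inverse_metric_form. Qed.

(** The metric being invariant, only the two factors dphi are differentiated; this is
    [lie_contraction] with no free index. *)
Lemma xder_kinetic y : U y ->
  xder X kin y = dual_form (G y) (dscalar phic y) (dscalar f y) *+ 2.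
Proof.
move=> Uy.
have := lie_contraction Uo (smooth_metric_mx hA hg Ac) (metric_unit hg Ac)
  (metric_killing hA hxi Ac) (T := grad2) [tuple] Uy sgrad2.
rewrite act_tuple0 addr0 => E; apply: etrans E _.
transitivity (\sum_a \sum_b inverse_metric g c y a b *
    (pd a f y * pd b phic y + pd a phic y * pd b f y)).
  apply: eq_bigr => a _; apply: eq_bigr => b _.
  by rewrite lie_grad2.
under eq_bigr do under eq_bigr do rewrite mulrDr.
under eq_bigr do rewrite big_split.
rewrite big_split /= !inverse_metric_form.
by rewrite [in X in X + _]dual_form_tr ?mulr2n //; exact: (metric_mx_sym hg Ac Uy).
Qed.

(** An identity for any Killing field, with no field equation: set to zero it is the gradient
    equation, and read directly it gives the converse part. *)
Lemma lie_stress_energy y I : U y ->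
  lie xi (stress_energy g V phi) c y I =
  pd (tnth I ord0) f y * pd (tnth I ord_max) phic y +
  pd (tnth I ord0) phic y * pd (tnth I ord_max) f y -
  (dual_form (G y) (dscalar phic y) (dscalar f y) +
   derive1 V (phic y) * f y) * g c y I.
Proof.
move=> Uy; have dx := xder_derivation X Uo Uy.
have sg J : smooth_on U (fun z => g c z J) by apply: (smooth_g hg Ac).
have sk := smooth_kinetic.
(* [T1] gathers the terms within reach of the smooth calculus; only V(phi) g stays outside. *)
pose T1 z J := grad2 z J - 2^-1 * kin z * g c z J.
have sk2 : smooth_on U (fun z => 2^-1 * kin z).
  by apply: smoothM => //; exact: smooth_cst.
have skg J : smooth_on U (fun z => 2^-1 * kin z * g c z J) by exact: smoothM.
have sT1 J : smooth_on U (fun z => T1 z J) by exact: smoothB.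
have SE z J : stress_energy g V phi c z J = T1 z J - V (phic z) * g c z J.
  by rewrite stress_energyE /T1 -/(kin z) mulrDl opprD addrA.
have -> : lie xi (stress_energy g V phi) c y I =
   (xder X (fun z => T1 z I) y + act (vjac X y) (T1 y) I) -
   derive1 V (phic y) * f y * g c y I - V (phic y) * lie xi g c y I.
  rewrite !lieE.
  have -> : act (vjac (xi c) y) (stress_energy g V phi c y) I =
      act (vjac X y) (T1 y) I - V (phic y) * act (vjac X y) (g c y) I.
    by rewrite -actZt -actNt -actDt; apply: eq_act => J; rewrite SE.
  have -> : xder (xi c) (fun z => stress_energy g V phi c z I) y =
      xder X (fun z => T1 z I) y -
      (derive1 V (phic y) * f y * g c y I + V (phic y) * xder X (fun z => g c z I) y).
    transitivity (xder X (fun z => T1 z I - V (phic z) * g c z I) y).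
      by apply: (der_eq dx) => z _; exact: SE.
    rewrite /f /xder mulr_sumr mulr_suml mulr_sumr -big_split -sumrB.
    apply: eq_bigr => a _ /=.
    rewrite (pd_sub_comp_mul a Uo sphi (sg I) (sT1 I) Uy (@hV (phic y))).
    by rewrite mulrBr mulrDr; congr (_ - (_ + _)); ring.
  by rewrite -/X; ring.
rewrite (lie_metric hxi Ac) // mulr0 subr0 mulrDl opprD addrA; congr (_ - _).
have -> : xder X (fun z => T1 z I) y =
    xder X (fun z => grad2 z I) y -
    (2^-1 * xder X kin y * g c y I + 2^-1 * kin y * xder X (fun z => g c z I) y).
  by rewrite -(derZ dx) // -(derM dx sk2 (sg I)) -(derB Uo dx (sgrad2 I) (skg I)).
have -> : act (vjac X y) (T1 y) I = act (vjac X y) (grad2 y) I -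
    2^-1 * kin y * act (vjac X y) (g c y) I.
  by rewrite -actZt -actNt -actDt.
have Lg : xder X (fun z => g c z I) y + act (vjac X y) (g c y) I = 0.
  by rewrite -lieE (lie_metric hxi Ac).
rewrite -lie_grad2 // xder_kinetic //.
move: Lg; move: (xder X (fun z => g c z I) y) => p /eqP.
rewrite addr_eq0 => /eqP ->.
by field.
Qed.

(** On the open set U the field equation makes T a constant multiple of E, so the derivation can be
    applied to E, whose smoothness and invariance are known. *)
Lemma lie_stress_energy_eq0 (eps : @tensor_field R D M D) (E : @curvature_poly R D 2) :
  gravitational_field_equation A g eps E V phi ->
  forall y I, U y -> lie xi (stress_energy g V phi) c y I = 0.
Proof.
move=> [hE eqE] y I Uy; have dx := xder_derivation X Uo Uy.
have [sE LE] := curvature_eval_invariant hA hg hxi Ac hE.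
have k0 : 8 * pi != 0 :> R by rewrite mulf_neq0 ?pnatr_eq0 // gt_eqF // pi_gt0.
have SE z J : U z -> stress_energy g V phi c z J =
    (8 * pi)^-1 * curvature_eval g eps E c z J.
  by move=> Uz; rewrite eqE // mulKf.
rewrite lieE (eq_act _ _ (fun J => @SE y J Uy)) actZt.
rewrite (der_eq dx (fun z => @SE z I)) (derZ dx) //.
by rewrite -mulrDr -lieE LE // mulr0.
Qed.

Hypothesis invariant_stress :
  forall y I, U y -> lie xi (stress_energy g V phi) c y I = 0.

Lemma gradient_equation y : U y ->
  (dscalar phic y)^T *m dscalar f y + (dscalar f y)^T *m dscalar phic y =
  (dual_form (G y) (dscalar phic y) (dscalar f y) + derive1 V (phic y) * f y) *: G y.
Proof.
move=> Uy; apply/matrixP => a b.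
have := lie_stress_energy [tuple a; b] Uy; rewrite invariant_stress // => E.
rewrite add_mxE 2![(_ *m _) a b]mxE !big_ord1 [_^T a _]mxE [_^T a _]mxE.
rewrite ![dscalar _ _ _ _]mxE [RHS]mxE metric_mxE.
move/esym/eqP: E; rewrite subr_eq0 => /eqP <-.
by rewrite addrC.
Qed.

Lemma potential_term_eq0 y : (1 < D)%N -> U y -> derive1 V (phic y) * f y = 0.
Proof.
move=> D1 Uy; apply: symmetric_product_trace_part D1 _ _ (gradient_equation Uy).
  exact: (metric_mx_sym hg Ac).
exact: (metric_unit hg Ac).
Qed.

Lemma dscalar_lie_eq0 (W : set 'rV[R]_D) : open W -> W `<=` U ->
  (forall y, W y -> derive1 V (phic y) = 0) ->
  forall y, W y -> dscalar f y = 0.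
Proof.
move=> Wo WU V0.
pose s z := dual_form (G z) (dscalar phic z) (dscalar f z).
have eqn z : W z -> (dscalar phic z)^T *m dscalar f z +
    (dscalar f z)^T *m dscalar phic z = s z *: G z.
  by move=> Wz; rewrite gradient_equation ?V0 ?mul0r ?addr0 //; exact: WU.
(* Near a point with [s <> 0] the gradient of phi would be null, and the
   derivative of its norm along xi is [2 s]. *)
have s0 y : W y -> s y = 0.
  move=> Wy; have Uy := WU _ Wy; apply/eqP; apply: contraT => sy.
  (* X(kin) = 2 s is smooth, and this keeps [s] nonzero in a neighbourhood of y. *)
  have xs z : U z -> xder X kin z = s z *+ 2 by move=> Uz; exact: xder_kinetic.
  have sx : smooth_on U (xder X kin) := smooth_xder Uo sX smooth_kinetic.
  have [W' [W'o W'y W'P]] : exists W', [/\ open W', W' y &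
      forall z, W' z -> W z /\ xder X kin z != 0].
    apply: (@near_open _ _ (fun z => W z /\ xder X kin z != 0)); apply: filterI.
      exact: open_nbhs_nbhs.
    by apply: (@smooth_neq0_near _ _ U) => //; rewrite xs // mulrn_eq0.
  have kin0 z : W' z -> kin z = 0.
    move=> /W'P[Wz]; have Uz := WU _ Wz; rewrite xs // mulrn_eq0 /= => sz.
    have [+ _] := symmetric_product_contract (metric_mx_sym hg Ac Uz)
      (metric_unit hg Ac Uz) (eqn z Wz).
    rewrite subrr scale0r => /eqP; rewrite scaler_eq0 => /orP[/eqP <-|/eqP w0].
      exact: kineticE.
    by move: sz; rewrite /s w0 /dual_form trmx0 mulmx0 mxE eqxx.
  have [_] := W'P _ W'y.
  rewrite (der_eq (xder_derivation X W'o W'y) kin0).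
  by rewrite (der_cst (xder_derivation X W'o W'y)) eqxx.
move=> y Wy; have Uy := WU _ Wy; apply/eqP; apply: contraT => /rV0Pn[b].
rewrite mxE => wb.
have [W' [W'o W'y W'P]] : exists W', [/\ open W', W' y &
    forall z, W' z -> W z /\ pd b f z != 0].
  apply: (@near_open _ _ (fun z => W z /\ pd b f z != 0)); apply: filterI.
    exact: open_nbhs_nbhs.
  by apply: (@smooth_neq0_near _ _ U) => //; exact: smooth_pd.
have f0 z : W' z -> f z = 0.
  move=> /W'P[Wz wz]; have w0 : dscalar f z != 0.
    by apply/rV0Pn; exists b; rewrite mxE.
  have := eqn z Wz; rewrite s0 // scale0r => /symmetric_product_eq0 /(_ w0) u0.
  apply: big1 => a _; have /rowP/(_ a) := u0.
  by rewrite !mxE => ->; rewrite mulr0.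
by move: wb; rewrite (pd_eq_on b W'o W'y f0) pd_cst eqxx.
Qed.

End ScalarField.

(** * Orbits *)

Section Orbits.
Context {R : realType} (D : nat) (M : topologicalType).
Variables (A : set (@chart R D M)) (xi : @vector_field R D M) (phi : M -> R).
Hypotheses (hA : is_atlas A) (hphi : smooth_function A phi).
Hypothesis sxi : forall c, A c -> forall a, smooth_on (cimg c) (fun y => xi c y a).

Definition xi_phi (c : @chart R D M) : 'rV[R]_D -> R :=
  xder (xi c) (fun y => phi (cinv c y)).

Lemma chart_exists p : exists2 c, A c & cdom c p.
Proof.
have [_ cov _] := hA; have : (\bigcup_(c in A) cdom c) p by rewrite cov.
by case=> c Ac cp; exists c.
Qed.

Lemma smooth_xi_phi c : A c -> smooth_on (cimg c) (xi_phi c).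
Proof.
by move=> Ac; apply: smooth_xder; [exact: cimg_open Ac|exact: sxi|exact: hphi].
Qed.

Lemma continuous_scalar : continuous phi.
Proof.
move=> p; have [c Ac cp] := chart_exists p.
have [/(_ c Ac)[co _ cK cc _] _ _] := hA.
have Up : cimg c (cmap c p) by exists p.
have hc : {for cmap c p, continuous (fun y => phi (cinv c y))}.
  exact: smooth_cont (hphi Ac) Up.
have : {for p, continuous ((fun y => phi (cinv c y)) \o cmap c)}.
  by apply: continuous_comp => //; exact: cc.
rewrite /prop_for /continuous_at /= cK // => h.
apply: cvg_trans h; apply: near_eq_cvg.
have : nbhs p (cdom c) by exact: open_nbhs_nbhs.
by apply: filterS => q cq /=; rewrite cK.
Qed.

Lemma derive_along_integral_curve (gamma : R -> M) c h t :
  integral_curve A xi setT gamma -> A c -> cdom c (gamma t) ->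
  smooth_on (cimg c) h ->
  is_derive t 1 (fun s => h (cmap c (gamma s))) (xder (xi c) h (cmap c (gamma t))).
Proof.
move=> hgam Ac ct sh; have [_ /(_ c Ac ct) dg] := hgam t I.
apply: (derive_along_curve (cimg_open hA Ac) (sh 1%N) _ dg).
by exists (gamma t).
Qed.

Lemma near_in_chart (gamma : R -> M) c t :
  integral_curve A xi setT gamma -> A c -> cdom c (gamma t) ->
  \forall s \near t, cdom c (gamma s).
Proof.
move=> hgam Ac ct; have [gc _] := hgam t I.
have [/(_ c Ac)[co _ _ _ _] _ _] := hA.
by apply: gc; exact: open_nbhs_nbhs.
Qed.

Lemma derive_scalar_along (gamma : R -> M) c t :
  integral_curve A xi setT gamma -> A c -> cdom c (gamma t) ->
  is_derive t 1 (phi \o gamma) (xi_phi c (cmap c (gamma t))).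
Proof.
move=> hgam Ac ct; have [/(_ c Ac)[_ _ cK _ _] _ _] := hA.
have := derive_along_integral_curve hgam Ac ct (hphi Ac).
apply: near_eq_is_derive; apply: filterS (near_in_chart hgam Ac ct) => s cs /=.
by rewrite cK.
Qed.

(** The curve may pass through many charts. [derive1 psi] refers to none of them, so the chartwise
    computations combine to psi'' = 0 on the whole line, and psi' is the constant found at 0. *)
Lemma scalar_affine_along (gamma : R -> M) c :
  integral_curve A xi setT gamma -> A c -> cdom c (gamma 0) ->
  (forall t c', A c' -> cdom c' (gamma t) ->
     dscalar (xi_phi c') (cmap c' (gamma t)) = 0) ->
  forall t, phi (gamma t) = phi (gamma 0) + t * xi_phi c (cmap c (gamma 0)).
Proof.
move=> hgam Ac c0 d0; pose psi : R -> R := phi \o gamma.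
have dpsi c' t : A c' -> cdom c' (gamma t) ->
    is_derive t 1 psi (xi_phi c' (cmap c' (gamma t))).
  exact: derive_scalar_along.
have ddpsi (t : R) : is_derive t (1 : R) (derive1 psi) 0.
  have [c' Ac' ct] := chart_exists (gamma t).
  have := derive_along_integral_curve hgam Ac' ct (smooth_xi_phi Ac').
  have -> : xder (xi c') (xi_phi c') (cmap c' (gamma t)) = 0.
    apply: big1 => a _; have /rowP/(_ a) := d0 t c' Ac' ct.
    by rewrite !mxE => ->; rewrite mulr0.
  apply: near_eq_is_derive; apply: filterS (near_in_chart hgam Ac' ct) => s cs /=.
  by rewrite derive1E; case: (dpsi c' s Ac' cs).
have psi' (t : R) : derive1 psi t = xi_phi c (cmap c (gamma 0)).
  have -> : derive1 psi t = derive1 psi 0 by exact: is_derive_0_is_cst ddpsi.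
  by rewrite derive1E; case: (dpsi c 0 Ac c0).
set k := xi_phi c _ in psi' *.
pose h (t : R) := psi t - k * t.
have dh (t : R) : is_derive t 1 h 0.
  have [c' Ac' ct] := chart_exists (gamma t).
  have dp : is_derive t 1 psi k.
    have d := dpsi c' t Ac' ct; apply: DeriveDef; first by case: d.
    by rewrite -derive1E.
  have dk : is_derive t 1 (fun s : R => k * s) k.
    have := is_deriveZ k (is_derive_id t (1 : R)).
    by rewrite [k *: 1]mulr1.
  have := is_deriveB dp dk; rewrite subrr; exact.
move=> t; have := is_derive_0_is_cst t 0 dh.
rewrite /h /psi /= mulr0 subr0 => /eqP; rewrite subr_eq => /eqP ->.
by rewrite mulrC.
Qed.

Lemma bounded_affine_eq0 (a k N : R) : (forall t : R, `|a + t * k| <= N) -> k = 0.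
Proof.
move=> H; apply/eqP; apply: contraT => k0.
(* This parameter makes the affine function equal to N + 1. *)
have := H ((N + 1 - a) / k); rewrite divfK // addrCA subrr addr0.
by move/(le_trans (ler_norm _)); lra.
Qed.

(** On a compact orbit continuity already bounds phi, so no periodic parametrisation is needed and
    both kinds of orbit are treated alike. *)
Lemma bounded_along_orbit p : 
  compact (orbit_of A xi p) \/ bounded_set (phi @` orbit_of A xi p) ->
  exists N : R, forall q, orbit_of A xi p q -> `|phi q| <= N.
Proof.
move=> H; have : bounded_set (phi @` orbit_of A xi p).
  case: H => // cp; apply: compact_bounded; apply: continuous_compact => //.
  by apply: continuous_subspaceT; exact: continuous_scalar.
move=> [N [_ HN]]; exists (N + 1) => q oq.
(* [bounded_set] grants the bound only for reals strictly above its witness. *)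
by apply: (HN (N + 1)); [rewrite ltrDl|exists q].
Qed.

Lemma scalar_inherits p c : A c -> cdom c p -> complete_orbit A xi p ->
  compact (orbit_of A xi p) \/ bounded_set (phi @` orbit_of A xi p) ->
  (forall q c', orbit_of A xi p q -> A c' -> cdom c' q ->
     dscalar (xi_phi c') (cmap c' q) = 0) ->
  xi_phi c (cmap c p) = 0.
Proof.
move=> Ac cp [gamma [g0 hgam]] /bounded_along_orbit[N HN] d0.
have orb t : orbit_of A xi p (gamma t).
  exists setT, gamma, t; split=> //; exact: openT.
have c0 : cdom c (gamma 0) by rewrite g0.
have aff := scalar_affine_along hgam Ac c0 (fun t c' => d0 _ c' (orb t)).
rewrite -g0; apply: (@bounded_affine_eq0 (phi (gamma 0)) _ N) => t.
by rewrite -aff; exact: HN.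
Qed.

End Orbits.

(** * From charts to invariant open sets *)

Lemma orbit_refl (R : realType) D (M : topologicalType) (A : set (@chart R D M)) xi p :
  complete_orbit A xi p -> orbit_of A xi p p.
Proof.
by move=> [gamma [g0 hg]]; exists setT, gamma, 0; split=> //; exact: openT.
Qed.

(** Written with [cinv], the part of the chart image lying over [O] is open by continuity of [cinv]
    on the image. *)
Lemma chart_region_open (R : realType) D (M : topologicalType) (c : @chart R D M)
  (O : set M) : is_chart c -> open O ->
  open [set y | cimg c y /\ O (cinv c y)].
Proof.
move=> [_ Uo _ _ ic] Oo; rewrite openE => y [Uy Oy]; apply: filterI.
  exact: open_nbhs_nbhs.
by apply: (ic y Uy); exact: open_nbhs_nbhs.
Qed.

Unset Implicit Arguments.

Theorem theorem1 (R : realType) (D : nat) (M : topologicalType)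
  (A : set (@chart R D M))
  (hD : (2 <= D)%N)
  (hHausdorff : hausdorff_space M)
  (hParacompact : paracompact M)
  (hConnected : connected [set: M])
  (hA : is_atlas A)
  (g : @tensor_field R D M 2) (hg : is_lorentzian_metric A g)
  (phi : M -> R) (hphi : smooth_function A phi)
  (V : R -> R) (hV : forall s, derivable V s 1)
  (xi : @vector_field R D M) (hxi : killing A g xi) :
  (forall (E : @curvature_poly R D 2) (eps : @tensor_field R D M D),
     gravitational_field_equation A g eps E V phi ->
     (forall p, derive1 V (phi p) <> 0 ->
        vanishes_at A (lie xi (scalar_field phi)) p) /\
     (forall O, xi_open A xi O ->
        (forall p, O p -> derive1 V (phi p) = 0) ->
        C1_function_on A O (lie xi (scalar_field phi)) ->
        (forall p, O p ->
           vanishes_at A (differential (lie xi (scalar_field phi))) p) /\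
        ((forall p, O p -> complete_orbit A xi p) ->
         (forall p, O p ->
            compact (orbit_of A xi p) \/
            bounded_set (phi @` orbit_of A xi p)) ->
         forall p, O p -> vanishes_at A (lie xi (scalar_field phi)) p))) /\
  (forall O, xi_open A xi O ->
     (forall p, O p ->
        vanishes_at A (differential (lie xi (scalar_field phi))) p) ->
     (forall p, O p -> forall c, A c -> cdom c p ->
        derive1 V (phi p) * lie xi (scalar_field phi) c (cmap c p) [tuple] = 0) ->
     forall p, O p -> vanishes_at A (lie xi (stress_energy g V phi)) p).
Proof.
have [hcharts _ _] := hA.
have in_img (c : @chart R D M) p : cdom c p -> cimg c (cmap c p) by exists p.
have cmapK c p : A c -> cdom c p -> cinv c (cmap c p) = p.
  by move=> /hcharts[_ _ + _ _]; exact.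
split=> [E eps hE|O hO dL0 VL0 p Op c Ac cp I].
  have inv c (Ac : A c) := lie_stress_energy_eq0 hA hg hxi Ac hE.
  split=> [p Vp c Ac cp I|O hO V0 _].
    rewrite lie_scalar; have := potential_term_eq0 hA hg hxi hphi hV Ac (inv c Ac)
      hD (in_img c p cp).
    by rewrite cmapK // => /eqP; rewrite mulf_eq0 => /orP[/eqP|/eqP].
  have [_ Oo orbO] := hO.
  have d0 p c : O p -> A c -> cdom c p -> dscalar (xi_phi xi phi c) (cmap c p) = 0.
    move=> Op Ac cp.
    (* V' vanishes on the whole chart region over O, not just at p, as an argument by
       differentiation requires. *)
    apply: (dscalar_lie_eq0 hA hg hxi hphi hV Ac (inv c Ac)
      (chart_region_open (hcharts c Ac) Oo)) => [y [] //|y [Uy Oy]|].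
      exact: V0.
    by split; [exact: in_img|rewrite cmapK].
  split=> [p Op c Ac cp I|hcompl hcb p Op c Ac cp I].
    rewrite differential_lie; have /rowP/(_ (thead I)) := d0 p c Op Ac cp.
    by rewrite !mxE.
  (* The orbit through p contains p, hence meets O, and the invariance of O leaves only
     inclusion. *)
  have orbitO : orbit_of A xi p `<=` O.
    case: (orbO p) => // /seteqP[+ _] => /(_ p); case; split=> //.
    exact/orbit_refl/hcompl.
  rewrite lie_scalar; apply: (scalar_inherits hA hphi _ Ac cp (hcompl p Op) (hcb p Op)).
    by move=> c' Ac' a; exact: (smooth_xi hxi).
  by move=> q c' /orbitO Oq; exact: d0.
have dL a : pd a (xi_phi xi phi c) (cmap c p) = 0.
  by have := dL0 p Op c Ac cp [tuple a]; rewrite differential_lie theadE.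
have := VL0 p Op c Ac cp; rewrite lie_scalar => VL.
(* With d(xi(phi)) = 0 the gradient products and g(dphi, d(xi(phi))) drop out, and the remaining
   coefficient of g is V'(phi) xi(phi) = 0. *)
rewrite (lie_stress_energy hA hg hxi hphi hV Ac I (in_img c p cp)) cmapK //.
rewrite -/(xi_phi xi phi c) !dL VL mul0r mulr0 !add0r addr0.
have -> : dscalar (xi_phi xi phi c) (cmap c p) = 0.
  by apply/rowP => a; rewrite !mxE.
by rewrite /dual_form trmx0 mulmx0 mxE mul0r oppr0.
Qed.
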